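(* Let $d\geq 1$ be an integer and let $\Theta\in\{\max,\ \mathrm{prod}^{1/d}\}$, where $\max(\mathbf{q})=\max(q_1,\dots,q_d)$ and $\mathrm{prod}^{1/d}(\mathbf{q})=(q_1q_2\cdots q_d)^{1/d}$ for $\mathbf{q}=(q_1,\dots,q_d)\in\mathbb{N}^d$. For $\tau>0$ let \[ S_\Theta(\tau)=\Big\{\mathbf{x}\in\mathbb{R}^d:\ |x_i-p_i/q_i|<\Theta(\mathbf{q})^{-\tau}\ (i=1,\dots,d)\ \text{for infinitely many } (p_1/q_1,\dots,p_d/q_d)\in\mathbb{Q}^d\Big\}, \] where each $p_i/q_i$ is in lowest terms with $p_i\in\mathbb{Z}$, $q_i\in\mathbb{N}$, and $\mathbf{q}=(q_1,\dots,q_d)$. Then for all $\tau\geq 2$, \[ \dim_H\big(S_\Theta(\tau)\big)=\frac{2d}{\tau}. \]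
   Context: $\dim_H$ denotes Hausdorff dimension. *)

(* Defs.v *)
From mathcomp Require Export all_boot all_order all_algebra.
From mathcomp Require Export all_classical all_reals all_analysis.

Set Implicit Arguments.
Unset Strict Implicit.
Unset Printing Implicit Defensive.

Import Order.TTheory GRing.Theory Num.Theory.

Local Open Scope classical_set_scope.
Local Open Scope ring_scope.

Section Hausdorff.
Context {R : realType} {T : Type} (dist : T -> T -> R).
Local Open Scope ereal_scope.

(* diameter of a nonempty set; -oo on set0 *)
Definition diameter (U : set T) : \bar R :=
  ereal_sup [set z | exists x y, [/\ U x, U y & z = (dist x y)%:E]].

(* Empty sets are singled out so that they contribute 0 also when s = 0,
   while nonempty sets then contribute 1 (counting measure). *)
Definition gauge (s : R) (U : set T) : \bar R :=
  if U == set0 then 0 else diameter U `^ s.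

Definition delta_cover (delta : R) (A : set T) (U : nat -> set T) : Prop :=
  A `<=` \bigcup_n U n /\ forall n, diameter (U n) <= delta%:E.

Definition hausdorff_premeasure (s delta : R) (A : set T) : \bar R :=
  ereal_inf [set \sum_(0 <= n <oo) gauge s (U n) | U in delta_cover delta A].

(* The premeasure is nonincreasing in delta, so the supremum is the limit as
   delta tends to 0. *)
Definition hausdorff_measure (s : R) (A : set T) : \bar R :=
  ereal_sup [set hausdorff_premeasure s delta A | delta in [set e | (0 < e)%R]].

Definition hausdorff_dim (A : set T) : \bar R :=
  ereal_inf [set s%:E | s in [set s | (0 <= s)%R /\ hausdorff_measure s A = 0]].

End Hausdorff.

Section Approximation.
Context {R : realType} {d : nat}.

Definition euclidean_dist (x y : 'rV[R]_d) : R :=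
  Num.sqrt (\sum_(i < d) (x ord0 i - y ord0 i) ^+ 2).

Definition theta_max (q : 'I_d -> nat) : R := (\max_(i < d) q i)%:R.

Definition theta_prod (q : 'I_d -> nat) : R :=
  (\prod_(i < d) q i)%:R `^ (d%:R^-1).

(* denq is the positive denominator of a rational in lowest terms *)
Definition denominators (r : 'rV[rat]_d) (i : 'I_d) : nat :=
  `|denq (r ord0 i)|%N.

Definition S_ (Theta : ('I_d -> nat) -> R) (tau : R) : set 'rV[R]_d :=
  [set x | infinite_set
     [set r : 'rV[rat]_d | forall i : 'I_d,
        `|x ord0 i - ratr (r ord0 i)| < Theta (denominators r) `^ (- tau)]].

End Approximation.

(* Main.v *)
Require Import Defs.
From mathcomp Require Import zify ring lra.
Set Implicit Arguments.
Unset Strict Implicit.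
Unset Printing Implicit Defensive.
Import Order.TTheory GRing.Theory Num.Theory.
Import numFieldNormedType.Exports.
Local Open Scope classical_set_scope.
Local Open Scope ring_scope.

(** Since [prod^(1/d) <= max], it suffices to bound the dimension from above for
    [prod^(1/d)] and from below for [max].

    Upper bound, for [s > 2 d / tau]: give a rational vector with entries
    [p_i / q_i] the weight [prod_i (q_i (1 + |p_i|))^-kappa], where [kappa > 1]
    and [2 kappa < tau s / d]. The weights are summable over all of [Q^d], and
    near any given point they dominate any constant multiple of
    [radius^s = (prod_i q_i)^(- tau s / d)] once [prod_i q_i] is large. The boxes
    with [radius^s <= eps * weight] are thus an efficient cover.

    Lower bound, for [u < 2 / tau]: build a Cantor set from rationals with
    denominators at most [Q_k] surrounded by intervals of radius
    [rho_k = Q_k^-tau]. Inside such an interval there are at least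
    [rho_k Q_(k+1)^2 / 800] rationals with denominator at most [Q_(k+1)], which
    are [Q_(k+1)^-2]-separated. If [Q_k] grows fast enough, an interval of length
    [L] carries a proportion [O(L^u)] of the points of each level finer than [L].
    The [d]-th power of the Cantor set lies in the set for [max], and counting
    products of points of a fine level (mass distribution) bounds its
    [u d]-dimensional measure from below. *)

(** * Rationals close to a given rational *)

Lemma sum_dvdn_divn (g X : nat) : (0 < g)%N ->
  (\sum_(i < X) (g %| i.+1))%N = (X %/ g)%N.
Proof.
move=> g0; elim: X => [|X IH]; first by rewrite big_ord0 div0n.
by rewrite big_ord_recr /= IH divnS// addnC.
Qed.

(** Telescoping: [1 / (2 h + 3)^2 <= 1 / ((2 h + 2) (2 h + 4)) = (1 / (h + 1) - 1 / (h + 2)) /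
    4]. *)
Lemma sum_inv_odd_sqr_le (F : realFieldType) (n : nat) :
  \sum_(h < n) ((2 * h + 3)%:R ^+ 2)^-1 <= 4^-1 :> F.
Proof.
suff : \sum_(h < n) ((2 * h + 3)%:R ^+ 2)^-1 <= 4^-1 - (4 * n.+1%:R)^-1 :> F.
  by move=> /le_trans; apply; rewrite gerBl invr_ge0 mulr_ge0.
elim: n => [|n IH]; first by rewrite big_ord0 mulr1 subrr.
rewrite big_ord_recr /=; apply: (le_trans (lerD IH (lexx _))).
have n0 : 0 <= n%:R :> F by [].
rewrite -lerBrDl natrD natrM -(natr1 n.+1) -(natr1 n).
set x := n%:R in n0 *.
have -> : 4^-1 - (4 * (x + 1 + 1))^-1 - (4^-1 - (4 * (x + 1))^-1) =
    ((2 * x + 2) * (2 * x + 4))^-1 :> F by field; lra.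
rewrite lef_pV2 ?posrE; first nra.
- by apply: exprn_gt0; lra.
- by apply: mulr_gt0; lra.
Qed.

(** The least prime factor of the gcd is 2 or an odd number [2 h + 3]. In the sieve below all odd
    numbers from 3 on stand in for the odd primes. *)
Lemma noncoprime_common_divisor (m n X : nat) : (0 < m <= X)%N ->
  ~~ coprime m n ->
  (2 %| m)%N && (2 %| n)%N \/
  exists h : 'I_X, (2 * h + 3 %| m)%N && (2 * h + 3 %| n)%N.
Proof.
move=> /andP[m0 mX] ncop.
have g1 : (1 < gcdn m n)%N.
  by rewrite ltn_neqAle eq_sym ncop gcdn_gt0 m0.
have [] := even_prime (pdiv_prime g1).
  by move=> p2; left; rewrite -p2 -dvdn_gcd pdiv_dvd.
move=> podd; right.
set p := pdiv (gcdn m n) in podd.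
have pm : (p %| m)%N by apply: (dvdn_trans (pdiv_dvd _)); rewrite dvdn_gcdl.
have pn : (p %| n)%N by apply: (dvdn_trans (pdiv_dvd _)); rewrite dvdn_gcdr.
have p1 : (1 < p)%N by apply: prime_gt1; exact: pdiv_prime.
have plem := dvdn_leq m0 pm.
have hX : ((p - 3) %/ 2 < X)%N by lia.
have pE : (2 * ((p - 3) %/ 2) + 3)%N = p.
  by move: podd p1; clear; move=> h1 h2; lia.
by exists (Ordinal hX); rewrite /= pE pm.
Qed.

(** Union bound over common divisors: 2 excludes at most [X Y / 4] pairs, and the odd numbers from 3
    on together at most another [X Y / 4]. *)
Lemma card_coprime_ge (X Y : nat) :
  (X * Y <= 2 * #|[set p : 'I_X * 'I_Y | coprime p.1.+1 p.2.+1]%SET|)%N.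
Proof.
set P := [set p | _]%SET.
pose f (g : nat) := (X %/ g * (Y %/ g))%N.
have hf g : (0 < g)%N -> (f g)%:R <= (X * Y)%:R * (g%:R ^+ 2)^-1 :> rat.
  move=> g0; rewrite /f !natrM expr2 invfM mulrACA.
  have h Z : (Z %/ g)%:R <= Z%:R / g%:R :> rat.
    by rewrite ler_pdivlMr ?ltr0n// -natrM ler_nat leq_trunc_div.
  exact: ler_pM.
have cardC : (#|~: P| <= f 2 + \sum_(h < X) f (2 * h + 3))%N.
  have fE g : (0 < g)%N ->
      f g = (\sum_(p : 'I_X * 'I_Y) ((g %| p.1.+1)%N && (g %| p.2.+1)%N))%N.
    move=> g0; rewrite /f -(sum_dvdn_divn X g0) -(sum_dvdn_divn Y g0).
    rewrite big_distrlr /= pair_bigA /=; apply: eq_bigr => p _.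
    by rewrite mulnb.
  have -> : (\sum_(h < X) f (2 * h + 3) = \sum_(h < X) \sum_(p : 'I_X * 'I_Y)
      ((2 * h + 3 %| p.1.+1) && (2 * h + 3 %| p.2.+1)))%N.
    by apply: eq_bigr => h _; rewrite -fE// addn_gt0 orbT.
  rewrite fE//.
  rewrite exchange_big -big_split /= -sum1_card big_mkcond /=.
  apply: leq_sum => p _; rewrite !inE; case: ifPn => //= ncop.
  have := @noncoprime_common_divisor p.1.+1 p.2.+1 X.
  rewrite ltn_ord => /(_ isT ncop) [->//|[h hh]].
  by rewrite (bigD1 h)//= hh addnCA.
have := cardsCs P; rewrite card_prod !card_ord.
have sumle : (f 2 + \sum_(h < X) f (2 * h + 3))%N%:R <= (X * Y)%:R / 2 :> rat.
  rewrite natrD natr_sum.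
  have h1 := hf 2%N isT.
  have h2 : \sum_(h < X) (f (2 * h + 3)%N)%:R <= (X * Y)%:R * 4^-1 :> rat.
    apply: le_trans (_ : (X * Y)%:R *
        \sum_(h < X) ((2 * h + 3)%:R ^+ 2)^-1 <= _); last first.
      by rewrite ler_wpM2l// sum_inv_odd_sqr_le.
    by rewrite mulr_sumr; apply: ler_sum => h _; apply: hf; rewrite addn_gt0 orbT.
  by move: h1 h2; set a := (X * Y)%:R; lra.
have cle : (#|~: P|)%:R <= (X * Y)%:R / 2 :> rat.
  by apply: le_trans sumle; rewrite ler_nat.
have : (2 * #|~: P|)%:R <= (X * Y)%:R :> rat by rewrite natrM; lra.
rewrite ler_nat => h eqP.
have lC : (#|~: P| <= X * Y)%N by lia.
by rewrite eqP; lia.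
Qed.

(** Among the [4 Z Y] pairs at least [2 Z Y] are coprime, and at most [Z Y] of these have a first
    entry at most [Z]. Discarding them keeps the denominators [B x + B' y] built from the pairs
    large. *)
Lemma coprime_pairs (Z Y : nat) : exists s : seq (nat * nat),
  [/\ uniq s, (Z * Y <= size s)%N &
   forall p, p \in s -> [/\ (Z < p.1 <= 4 * Z)%N, (0 < p.2 <= Y)%N & coprime p.1 p.2]].
Proof.
pose P := [set p : 'I_(4 * Z) * 'I_Y | coprime p.1.+1 p.2.+1]%SET.
pose B := [set p : 'I_(4 * Z) * 'I_Y | (p.1 < Z)%N]%SET.
pose e (p : 'I_(4 * Z) * 'I_Y) := (p.1.+1, p.2.+1).
have einj : injective e.
  by move=> [[a ?] [b ?]] [[a' ?] [b' ?]] [/= aa bb]; congr pair; apply/val_inj.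
exists (map e (enum (P :\: B))); split.
- by rewrite map_inj_uniq// enum_uniq.
- rewrite size_map -cardE.
  have := card_coprime_ge (4 * Z) Y.
  rewrite -/P -(cardsID B P).
  have : (#|P :&: B| <= Z * Y)%N.
    apply: (@leq_trans #|B|); first by rewrite subset_leq_card// subsetIr.
    have -> : B = finset.setX [set i : 'I_(4 * Z) | (i < Z)%N]%SET [set: 'I_Y]%SET.
      by apply/setP => p; rewrite !inE andbT.
    rewrite cardsX cardsT card_ord leq_mul2r; apply/orP; right.
    rewrite cardE -(size_map val) -[X in (_ <= X)%N](size_iota 0).
    apply: uniq_leq_size; first by rewrite (map_inj_uniq val_inj) enum_uniq.
    by move=> _ /mapP[i + ->]; rewrite mem_enum inE mem_iota.
  by move: #|_ :&: _| #|_ :\: _| => a b; nia.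
- move=> _ /mapP[[a b] + ->]; rewrite mem_enum !inE /= -leqNgt => /andP[h1 h2].
  by split; rewrite ?ltnS ?h1 ?ltn_ord.
Qed.

Lemma denq_div_le (p : int) (q : nat) : (0 < q)%N ->
  denq (p%:~R / q%:R) <= q%:Z.
Proof.
move=> q0; rewrite (_ : q%:R = q%:Z%:~R) ?pmulrn//.
have : 0 < q%:Z by []; case: divqP => // k x k0.
rewrite pmulr_lgt0 ?denq_gt0// => kp.
by rewrite ler_peMl ?denq_ge0// -gtz0_ge1.
Qed.

(** [(a, b)] completes [(numq r, denq r)] to an integer matrix of determinant 1. Reducing [b] modulo
    [denq r] keeps the denominators of later combinations small. *)
Lemma denq_bezout (r : rat) : exists (a b : int),
  [/\ a * denq r - numq r * b = 1, 0 <= b & b < denq r].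
Proof.
have [u [v]] := Bezoutz (numq r) (denq r).
have -> : gcdz (numq r) (denq r) = 1.
  by rewrite /gcdz (eqP (coprime_num_den r)).
move=> uv; pose k := divz (- u) (denq r).
have e := divz_eq (- u) (denq r).
exists (v - k * numq r), (modz (- u) (denq r)); split.
- rewrite -/k in e.
  have -> : modz (- u) (denq r) = - u - k * denq r by rewrite {2}e addrC addKr.
  by rewrite -uv; ring.
- by rewrite modz_ge0// denq_neq0.
- by rewrite ltz_pmod// denq_gt0.
Qed.

(** The hypothesis equates two distances [y / (b (b x + b' y))] after cross-multiplication; the
    terms in [b b' y y'] cancel. *)
Lemma cross_cancel (b b' x y x' y' : nat) : (0 < b)%N ->
  (y * (b * (b * x' + b' * y')) = y' * (b * (b * x + b' * y)) ->
   x * y' = x' * y)%N.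
Proof.
move=> b0 e; apply/eqP; rewrite -(eqn_pmul2l b0) -(eqn_pmul2l b0); apply/eqP.
by lia.
Qed.

Lemma coprime_cross_inj (x y x' y' : nat) :
  coprime x y -> coprime x' y' -> (x * y' = x' * y)%N -> (x, y) = (x', y').
Proof.
move=> c c' e.
have xx' : (x %| x')%N.
  by rewrite -(Gauss_dvdl x' c) -e dvdn_mulr.
have x'x : (x' %| x)%N.
  by rewrite -(Gauss_dvdl x c') e dvdn_mulr.
have yy' : (y %| y')%N.
  by rewrite coprime_sym in c; rewrite -(Gauss_dvdr y' c) e dvdn_mull.
have y'y : (y' %| y)%N.
  by rewrite coprime_sym in c'; rewrite -(Gauss_dvdr y c') -e dvdn_mull.
by congr pair; apply/eqP; rewrite eqn_dvd; apply/andP.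
Qed.

(* The fractions close to [r = A / B] are [(A x + A' y) / (B x + B' y)] with
   [x], [y] coprime and [A' B - A B' = 1]; such a fraction lies at distance
   [y / (B (B x + B' y))] from [r]. *)
Lemma many_close_rationals (R : realType) (r : rat) (Q Q' m : nat) (rho : R) :
  denq r <= Q%:Z -> 0 < rho -> rho * Q%:R ^+ 2 <= 1 -> 40 <= rho * Q'%:R ->
  m%:R < rho * Q'%:R ^+ 2 / 800 + 1 ->
  exists s : seq rat, [/\ uniq s, size s = m &
    forall r', r' \in s ->
      [/\ r' != r, `|ratr r' - ratr r| <= rho / 4 & denq r' <= Q'%:Z]].
Proof.
move=> rQ rho0 rhoQ rhoQ' mle.
have [A' [B' [AB B'0 B'r]]] := denq_bezout r.
have [b denE] : exists b : nat, denq r = b%:Z.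
  by exists `|denq r|%N; rewrite gez0_abs ?denq_ge0.
have [b' B'E] : exists b' : nat, B' = b'%:Z.
  by exists `|B'|%N; rewrite gez0_abs.
set A := numq r in AB.
rewrite {}B'E denE in AB B'0 B'r rQ *.
have bb' : (b' < b)%N by move: B'r; lia.
have bQ : (b <= Q)%N by move: rQ; lia.
have b0 : (0 < b)%N by lia.
have bR : 1 <= b%:R :> R by rewrite ler1n.
have bQR : b%:R <= Q%:R :> R by rewrite ler_nat.
have rhob : rho * b%:R ^+ 2 <= 1.
  by apply: le_trans rhoQ; rewrite ler_pM2l// lerXn2r// nnegrE.
have Q'b : 40 * b%:R <= Q'%:R :> R.
  have : 40 * (rho * b%:R ^+ 2) <= rho * Q'%:R by move: rhob rhoQ'; lra.
  rewrite mulrCA ler_pM2l//; apply: le_trans.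
  by rewrite ler_pM2l// expr2 ler_peMr//; lra.
(* With [Z < x <= 4 Z] and [y <= Y <= Z] the denominator [b x + b' y] is at most [5 b Z <= Q']. *)
pose Z := (Q' %/ (5 * b))%N.
have ZQ : (Z * (5 * b) <= Q')%N by rewrite leq_trunc_div.
have QZ : (Q' < Z.+1 * (5 * b))%N by rewrite ltn_ceil// muln_gt0 b0.
have ZR : Q'%:R <= 10 * b%:R * Z%:R :> R.
  have : Q'%:R <= (Z.+1 * (5 * b))%:R :> R by rewrite ler_nat ltnW.
  rewrite natrM -natr1 natrM.
  by move: Q'b bR; set q := Q'%:R; set c := b%:R; set z := Z%:R; lra.
have Z0 : 0 < Z%:R :> R.
  have : 0 < 10 * b%:R * Z%:R :> R by lra.
  by rewrite pmulr_rgt0// mulr_gt0//; lra.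
(* For [y <= w] the distance to [r] is at most [w / (b (b Z)) = rho / 4]. Since [1 <= w], truncating
   [w] to [Y] loses at most a factor 2. *)
pose w : R := rho * b%:R ^+ 2 * Z%:R / 4.
have w1 : 1 <= w.
  have : 40 <= rho * (10 * b%:R * Z%:R).
    by apply: (le_trans rhoQ'); rewrite ler_pM2l.
  have : rho * (10 * b%:R * Z%:R) <= rho * (10 * (b%:R ^+ 2) * Z%:R).
    rewrite ler_pM2l// ler_pM2r// ler_pM2l// expr2 ler_peMr//; lra.
  by rewrite /w; lra.
have w0 : 0 <= w by lra.
pose Y := Num.trunc w.
have Yw : Y%:R <= w by rewrite truncn_le.
have wY : w < Y.+1%:R by rewrite truncnS_gt.
have Y1 : (0 < Y)%N by rewrite truncn_gt0.
have wY2 : w <= 2 * Y%:R.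
  have : 1 <= Y%:R :> R by rewrite ler1n.
  by move: wY; rewrite -natr1; lra.
have YZ : (Y <= Z)%N.
  rewrite -(ler_nat R) (le_trans Yw)// /w.
  have : rho * b%:R ^+ 2 * Z%:R <= Z%:R by rewrite ler_piMl// ltW.
  by lra.
(* The 800: [Z Y >= Z w / 2 = rho b^2 Z^2 / 8], and [Q' <= 10 b Z] gives [b^2 Z^2 >= Q'^2 / 100]. *)
have mZY : (m <= Z * Y)%N.
  rewrite -ltnS -(ltr_nat R) -natr1 (lt_le_trans mle)// lerD2r natrM.
  have : Z%:R * w <= Z%:R * (2 * Y%:R) by rewrite ler_pM2l.
  have : Q'%:R ^+ 2 <= (10 * b%:R * Z%:R) ^+ 2 :> R.
    by rewrite lerXn2r// ?nnegrE// mulr_ge0// mulr_ge0//; lra.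
  rewrite -(ler_pM2l rho0) /w => h1 h2.
  have e : rho * (10 * b%:R * Z%:R) ^+ 2 =
    400 * (Z%:R * (rho * b%:R ^+ 2 * Z%:R / 4)) by field.
  by lra.
have [s [us ss hs]] := coprime_pairs Z Y.
pose q (p : nat * nat) := (b * p.1 + b' * p.2)%N.
pose f (p : nat * nat) : rat := (A * p.1%:Z + A' * p.2%:Z)%:~R / (q p)%:R.
have q0 p : p \in s -> (0 < q p)%N.
  by case/hs => /andP[Zp _] _ _; rewrite /q addn_gt0 muln_gt0 b0 (leq_ltn_trans _ Zp).
have rE : r = A%:~R / b%:R by rewrite -[LHS]divq_num_den denE.
have fr p : p \in s -> f p - r = p.2%:R / (b%:R * (q p)%:R).
  move=> ps; rewrite /f rE.
  have -> : p.2%:R = p.2%:R * (A' * b%:Z - A * b'%:Z)%:~R :> rat by rewrite AB mulr1.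
  have qR : (q p)%:R = b%:R * p.1%:R + b'%:R * p.2%:R :> rat.
    by rewrite /q natrD !natrM.
  have qn0 : b%:R * p.1%:R + b'%:R * p.2%:R != 0 :> rat.
    by rewrite -qR pnatr_eq0 -lt0n q0.
  have bn0 : b%:R != 0 :> rat by rewrite pnatr_eq0 -lt0n.
  rewrite qR !(rmorphD, rmorphB, rmorphM) /= -!pmulrn.
  by field; rewrite qn0.
have finj : {in s &, injective f}.
  move=> p p' ps p's ff'.
  have [_ _ cp] := hs _ ps; have [_ _ cp'] := hs _ p's.
  have : f p - r = f p' - r by rewrite ff'.
  rewrite !fr// => /eqP; rewrite eqr_div ?mulf_neq0 ?pnatr_eq0 -?lt0n ?q0//.
  rewrite -!natrM eqr_nat => /eqP e.
  have e2 : (p.1 * p'.2 = p'.1 * p.2)%N.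
    exact: cross_cancel b0 e.
  by have := coprime_cross_inj cp cp' e2; case: p p' {ps p's ff' cp cp' e e2} => ? ? [? ?].
exists (map f (take m s)); split.
- by rewrite map_inj_in_uniq ?take_uniq// => p p' /mem_take ? /mem_take ?; apply: finj.
- by rewrite size_map size_takel// (leq_trans mZY).
- move=> _ /mapP[p /mem_take ps ->].
  have [/andP[Zp1 p1Z] /andP[p20 p2Y] _] := hs _ ps.
  split.
  + rewrite -subr_eq0 fr// mulf_neq0 ?invr_eq0 ?mulf_neq0 ?pnatr_eq0 -?lt0n ?q0//.
  + rewrite -rmorphB /= fr// fmorph_div rmorphM /= !ratr_nat.
    have qR : b%:R * Z%:R <= (q p)%:R :> R.
      by rewrite -natrM ler_nat (leq_trans _ (leq_addr _ _))// leq_mul2l ltnW// orbT.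
    have qp : 0 < (q p)%:R :> R by rewrite ltr0n q0.
    have bp : 0 < b%:R :> R by lra.
    rewrite ger0_norm; last by rewrite divr_ge0// mulr_ge0.
    rewrite ler_pdivrMr ?mulr_gt0//.
    apply: (@le_trans _ _ w); first by apply: le_trans Yw; rewrite ler_nat.
    rewrite /w [leLHS](_ : _ = rho / 4 * (b%:R * (b%:R * Z%:R))); last by field.
    by rewrite ler_wpM2l ?ler_wpM2l//; lra.
  + apply: le_trans (denq_div_le _ (q0 _ ps)) _.
    rewrite lez_nat; apply: leq_trans ZQ.
    have -> : (Z * (5 * b) = b * (4 * Z) + b * Z)%N by ring.
    apply: leq_add; first by rewrite leq_mul2l p1Z orbT.
    exact: (leq_mul (ltnW bb') (leq_trans p2Y YZ)).
Qed.

(** Multiplied by both denominators, the difference becomes a nonzero integer. *)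
Lemma rat_separation (R : realType) (r r' : rat) (Q Q' : nat) :
  r != r' -> denq r <= Q%:Z -> denq r' <= Q'%:Z ->
  1 <= `|ratr r - ratr r'| * (Q%:R * Q'%:R) :> R.
Proof.
move=> rr' rQ rQ'.
suff h : 1 <= `|r - r'| * ((denq r)%:~R * (denq r')%:~R).
  have Qr : (denq r)%:~R <= Q%:R :> rat by rewrite pmulrn ler_int.
  have Q'r : (denq r')%:~R <= Q'%:R :> rat by rewrite pmulrn ler_int.
  have : 1 <= `|r - r'| * (Q%:R * Q'%:R).
    apply: (le_trans h); rewrite ler_wpM2l// ler_pM// ler0z denq_ge0//.
  rewrite -(ler_rat R) rmorph1 !rmorphM /= !ratr_nat ratr_norm.
  by rewrite rmorphB.
have d0 : 0 < (denq r)%:~R * (denq r')%:~R :> rat.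
  by rewrite mulr_gt0// ltr0z denq_gt0.
rewrite -[X in _ * X](gtr0_norm d0) -normrM.
have -> : (r - r') * ((denq r)%:~R * (denq r')%:~R) =
    (numq r * denq r' - numq r' * denq r)%:~R :> rat.
  by rewrite rmorphB !rmorphM /= !numqE; ring.
have : (r - r') * ((denq r)%:~R * (denq r')%:~R) != 0.
  by rewrite mulf_neq0 ?subr_eq0// gt_eqF.
have -> : (r - r') * ((denq r)%:~R * (denq r')%:~R) =
    (numq r * denq r' - numq r' * denq r)%:~R :> rat.
  by rewrite rmorphB !rmorphM /= !numqE; ring.
rewrite intr_eq0 => h; rewrite -intr_norm ler1z.
by rewrite -gtz0_ge1 normr_gt0.
Qed.

Definition close_to {R : realType} (c e : R) : pred rat :=
  fun r => `|ratr r - c| <= e.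

(** By [rat_separation] distinct elements are at least [Q^-2] apart, so scaling by [Q^2] and
    truncating is injective, with values at most [2 e Q^2]. *)
Lemma count_separated (R : realType) (s : seq rat) (Q : nat) (c e : R) :
  uniq s -> (forall r, r \in s -> denq r <= Q%:Z) -> 0 <= e ->
  (count (close_to c e) s)%:R <= 2 * e * Q%:R ^+ 2 + 1.
Proof.
move=> us sQ e0; rewrite -size_filter; set s' := seq.filter _ _.
pose f (r : rat) := Num.trunc ((ratr r - c + e) * Q%:R ^+ 2).
have inS r : r \in s' -> [/\ 0 <= ratr r - c + e, ratr r - c + e <= 2 * e & r \in s].
  rewrite mem_filter /close_to => /andP[+ ->]; rewrite ler_norml => /andP[h1 h2].
  by split => //; lra.
have finj : {in s' &, injective f}.
  move=> r r' /inS[h1 _ rs] /inS[h1' _ rs'] ff'; apply/eqP; apply: contraT => rr'.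
  have := rat_separation R rr' (sQ _ rs) (sQ _ rs').
  have := truncn_itv (mulr_ge0 h1 (sqr_ge0 (Q%:R : R))).
  have := truncn_itv (mulr_ge0 h1' (sqr_ge0 (Q%:R : R))).
  rewrite -/(f r) -/(f r') ff' -natr1 -expr2 => /andP[a1 a2] /andP[b1 b2].
  rewrite -[X in _ * X](@ger0_norm _ (Q%:R ^+ 2)) ?sqr_ge0// -normrM.
  have : `|(ratr r - ratr r') * Q%:R ^+ 2| < 1 :> R.
    by rewrite ltr_norml; apply/andP; split; lra.
  by move=> h; rewrite leNgt h.
have t0 : 0 <= 2 * e * Q%:R ^+ 2 by rewrite mulr_ge0 ?sqr_ge0// mulr_ge0.
have : (size s' <= (Num.trunc (2 * e * Q%:R ^+ 2)).+1)%N.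
  rewrite -(size_map f) -[X in (_ <= X)%N](size_iota 0).
  apply: uniq_leq_size; first by rewrite map_inj_in_uniq// filter_uniq.
  move=> _ /mapP[r /inS[h1 h2 _] ->]; rewrite mem_iota /= add0n ltnS.
  by apply: le_truncn; rewrite ler_wpM2r// sqr_ge0.
rewrite -(ler_nat R) => /le_trans; apply.
by rewrite -natr1 lerD2r truncn_le.
Qed.

Lemma uniq_flatten_map (S T : eqType) (f : S -> seq T) (s : seq S) :
  uniq s -> {in s, forall x, uniq (f x)} ->
  {in s &, forall x y, x != y -> ~~ has (mem (f x)) (f y)} ->
  uniq (flatten (map f s)).
Proof.
elim: s => //= x s IH /andP[xs us] uf dis; rewrite cat_uniq uf ?mem_head//=.
rewrite IH//; last 2 first.
- by move=> y ys; apply: uf; rewrite inE ys orbT.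
- by move=> y z ys zs; apply: dis; rewrite inE ?ys ?zs orbT.
rewrite andbT; apply/hasPn => z /flattenP[_ /mapP[y ys ->] zy].
have yx : x != y by apply: contraNneq xs => ->.
have ys' : y \in x :: s by rewrite inE ys orbT.
by have /hasPn := dis x y (mem_head _ _) ys' yx; apply.
Qed.

(** * Radii of the intervals and the choice of the next scale *)

Definition radius {R : realType} (tau : R) (q : nat) : R := q%:R `^ (- tau).

Section Radius.
Context {R : realType}.
Implicit Types tau u : R.

Lemma radius_gt0 tau q : (0 < q)%N -> 0 < radius tau q.
Proof. by move=> q0; rewrite powR_gt0// ltr0n. Qed.

Lemma radius1 tau : radius tau 1 = 1.
Proof. by rewrite /radius powR1. Qed.

Lemma radius_le tau q q' : 0 <= tau -> (0 < q)%N -> (q <= q')%N ->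
  radius tau q' <= radius tau q.
Proof.
move=> t0 q0 qq'; rewrite /radius !powRN lef_pV2 ?posrE ?powR_gt0 ?ltr0n//.
- by rewrite ge0_ler_powR ?nnegrE// ler_nat.
- exact: leq_trans qq'.
Qed.

(** Here [2 <= tau] enters: the radius does not exceed the gap [q^-2] between rationals with
    denominators at most [q], so the families of children of different centres stay disjoint. *)
Lemma radius_sqr_le1 tau q : 2 <= tau -> (0 < q)%N ->
  radius tau q * q%:R ^+ 2 <= 1.
Proof.
move=> t2 q0; rewrite /radius powRN mulrC ler_pdivrMr ?powR_gt0 ?ltr0n// mul1r.
by rewrite -powR_mulrn// ler_powR// ler1n.
Qed.

Lemma radius_double_le tau q q' : 1 <= tau -> (0 < q)%N -> (2 * q <= q')%N ->
  radius tau q' <= radius tau q / 2.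
Proof.
move=> t1 q0 qq'.
apply: (@le_trans _ _ (radius tau (2 * q))).
  by rewrite radius_le//; [lra|rewrite muln_gt0].
rewrite /radius natrM powRM// mulrC ler_wpM2l ?powR_ge0//.
by rewrite powRN lef_pV2 ?posrE ?powR_gt0// le1r_powR//; lra.
Qed.

(** [m] will be the number of children of each centre. It is of order [rho q'^2], so [m] times the
    new radius to the power [u] is of order [rho q'^(2 - tau u)], which is large for large [q']
    because [tau u < 2]. *)
Lemma next_scale tau u q : 2 <= tau -> 0 < u -> tau * u < 2 -> (0 < q)%N ->
  exists q' m : nat, [/\ radius tau q' <= radius tau q / 2,
    40 <= radius tau q * q'%:R,
    1 <= m%:R * radius tau q' `^ u &
    radius tau q * q'%:R ^+ 2 / 800 <= m%:R < radius tau q * q'%:R ^+ 2 / 800 + 1].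
Proof.
move=> t2 u0 tu q0; set rho := radius tau q.
have rho0 : 0 < rho by exact: radius_gt0.
(* The three summands secure, in order, the mass inequality [1 <= m rho'^u], the bound by 40, and
   the halving of the radius. *)
pose x : R := (800 / rho) `^ (2 - tau * u)^-1 + 40 / rho + 2 * q%:R.
pose q' := (Num.trunc x).+1.
have : x < q'%:R by exact: truncnS_gt.
move: (q') => {}q'; rewrite {}/x => xq'.
have p1 : 0 <= (800 / rho) `^ (2 - tau * u)^-1 by exact: powR_ge0.
have p2 : 0 <= 40 / rho by rewrite divr_ge0// ltW.
have p3 : 0 <= q%:R :> R by [].
have [m] : exists m : nat,
    rho * q'%:R ^+ 2 / 800 <= m%:R < rho * q'%:R ^+ 2 / 800 + 1.
  set z := _ / 800; have z0 : 0 <= z.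
    by apply: divr_ge0; [rewrite mulr_ge0 ?sqr_ge0 ?ltW|exact: ler0n].
  have c0 : 0 <= Num.ceil z by rewrite ceil_ge0; lra.
  exists `|Num.ceil z|%N; rewrite natr_absz ger0_norm//.
  by have /andP[] := ceil_itv z; rewrite intrD => h1 h2; apply/andP; split; lra.
exists q', m; split => //.
- by apply: radius_double_le => //; [lra|rewrite -(ler_nat R) natrM; lra].
- have : 40 / rho <= q'%:R by lra.
  by rewrite ler_pdivrMr// mulrC.
- have /andP[h _] := p.
  apply: (@le_trans _ _ (rho * q'%:R ^+ 2 / 800 * radius tau q' `^ u)); last first.
    by rewrite ler_wpM2r ?powR_ge0.
  rewrite [leRHS](_ : _ = rho / 800 * (q'%:R ^+ 2 * radius tau q' `^ u)); last by field.
  have -> : q'%:R ^+ 2 * radius tau q' `^ u = q'%:R `^ (2 - tau * u).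
    rewrite /radius -powRrM -powR_mulrn// -powRD ?mulNr//.
    by rewrite gt_eqF ?implybT//; lra.
  have k0 : 0 < 2 - tau * u by lra.
  have : 800 / rho <= q'%:R `^ (2 - tau * u).
    have e0 : 0 <= 800 / rho by apply: divr_ge0; [exact: ler0n|exact: ltW].
    have -> : 800 / rho = ((800 / rho) `^ (2 - tau * u)^-1) `^ (2 - tau * u).
      by rewrite -powRrM (mulVf (lt0r_neq0 k0)) powRr1.
    by apply: ge0_ler_powR; rewrite ?nnegrE; [exact: ltW|exact: p1|exact: ler0n|lra].
  rewrite (ler_pdivrMr _ _ rho0) => h2.
  rewrite mulrAC ler_pdivlMr; last exact: ltr0Sn.
  by rewrite mul1r mulrC.
Qed.

End Radius.

(** * The Cantor construction *)

(** [F k] lists the centres of level [k]. [scheme_denq_gt] makes the levels disjoint, so that a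
    point near centres of all levels has infinitely many approximations. [scheme_count] compares
    proportions, cross-multiplied to stay in [nat]. *)
Record cantor_scheme (R : realType) (tau u : R) (Q : nat -> nat)
    (F : nat -> seq rat) : Prop := CantorScheme {
  scheme_Q0 : Q 0 = 1%N;
  scheme_F0 : F 0 = [:: 0];
  scheme_Q_gt0 : forall k, (0 < Q k)%N;
  scheme_radius : forall k, radius tau (Q k.+1) <= radius tau (Q k) / 2;
  scheme_uniq : forall k, uniq (F k);
  scheme_denq_le : forall k r, r \in F k -> denq r <= (Q k)%:Z;
  scheme_denq_gt : forall k r, r \in F k.+1 -> (Q k)%:Z < denq r;
  scheme_parent : forall k r', r' \in F k.+1 ->
    exists2 r, r \in F k & `|ratr r' - ratr r| <= radius tau (Q k) / 4;
  scheme_mass : forall k, 1 <= (size (F k))%:R * radius tau (Q k) `^ u;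
  scheme_size : forall k, (size (F k))%:R * radius tau (Q k) * (Q k.+1)%:R ^+ 2
    <= 800 * (size (F k.+1))%:R;
  scheme_count : forall k (c e : R),
    (count (close_to c e) (F k.+1) * size (F k) <=
     size (F k.+1) * count (close_to c (e + radius tau (Q k) / 4)) (F k))%N }.

(** All centres of level [k] receive the same number [m k] of children, so a proportion of centres
    passes unchanged to their children. *)
Lemma cantor_scheme_exists (R : realType) (tau u : R) :
  2 <= tau -> 0 < u -> tau * u < 2 ->
  exists (Q : nat -> nat) (F : nat -> seq rat), cantor_scheme tau u Q F.
Proof.
move=> t2 u0 tu.
have [G GP] : exists G : nat -> nat * nat, forall q, (0 < q)%N ->
    [/\ radius tau (G q).1 <= radius tau q / 2,
    40 <= radius tau q * (G q).1%:R,
    1 <= (G q).2%:R * radius tau (G q).1 `^ u &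
    radius tau q * (G q).1%:R ^+ 2 / 800 <= (G q).2%:R
      < radius tau q * (G q).1%:R ^+ 2 / 800 + 1].
  suff /choice[G GP] : forall q, exists p : nat * nat, (0 < q)%N ->
    [/\ radius tau p.1 <= radius tau q / 2,
    40 <= radius tau q * p.1%:R,
    1 <= p.2%:R * radius tau p.1 `^ u &
    radius tau q * p.1%:R ^+ 2 / 800 <= p.2%:R
      < radius tau q * p.1%:R ^+ 2 / 800 + 1] by exists G.
  move=> q; have [q0|] := boolP (0 < q)%N; last by exists (0%N, 0%N).
  by have [q' [m h]] := next_scale t2 u0 tu q0; exists (q', m).
pose Q k := iter k (fun q => (G q).1) 1%N.
pose m k := (G (Q k)).2.
have Q0 k : (0 < Q k)%N.
  elim: k => // k IH.
  have h : 40 <= radius tau (Q k) * (Q k.+1)%:R by have [] := GP _ IH.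
  by rewrite lt0n; apply/eqP => e; move: h; rewrite e mulr0; lra.
have rQ k : radius tau (Q k.+1) <= radius tau (Q k) / 2 by have [] := GP _ (Q0 k).
have QQ k : 40 <= radius tau (Q k) * (Q k.+1)%:R by have [] := GP _ (Q0 k).
have mr k : 1 <= (m k)%:R * radius tau (Q k.+1) `^ u by have [] := GP _ (Q0 k).
have mQ k : radius tau (Q k) * (Q k.+1)%:R ^+ 2 / 800 <= (m k)%:R
      < radius tau (Q k) * (Q k.+1)%:R ^+ 2 / 800 + 1.
  by have [] := GP _ (Q0 k).
have rho0 k : 0 < radius tau (Q k) by exact: radius_gt0.
have [ch chP] : exists ch : nat * rat -> seq rat, forall kr,
    denq kr.2 <= (Q kr.1)%:Z ->
    [/\ uniq (ch kr), size (ch kr) = m kr.1 &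
     forall r', r' \in ch kr -> [/\ r' != kr.2,
      `|ratr r' - ratr kr.2| <= radius tau (Q kr.1) / 4 & denq r' <= (Q kr.1.+1)%:Z]].
  suff /choice[ch chP] : forall kr, exists s : seq rat,
    denq kr.2 <= (Q kr.1)%:Z ->
    [/\ uniq s, size s = m kr.1 &
     forall r', r' \in s -> [/\ r' != kr.2,
      `|ratr r' - ratr kr.2| <= radius tau (Q kr.1) / 4 & denq r' <= (Q kr.1.+1)%:Z]]
    by exists ch.
  move=> [k r] /=; have [rk|] := boolP (denq r <= (Q k)%:Z); last by exists [::].
  have /andP[_ mk] := mQ k.
  have [s sP] := many_close_rationals rk (rho0 k) (radius_sqr_le1 t2 (Q0 k)) (QQ k) mk.
  by exists s.
pose F := fix F k := if k is k'.+1 then flatten (map (fun r => ch (k', r)) (F k'))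
  else [:: 0 : rat].
have FQ k r : r \in F k -> denq r <= (Q k)%:Z.
  elim: k r => [|k IH] r /=; first by rewrite inE => /eqP ->.
  move=> /flattenP[_ /mapP[r0 r0F ->]] rch.
  by have [_ _ /(_ _ rch)[]] := chP (k, r0) (IH _ r0F).
have chF k r : r \in F k -> [/\ uniq (ch (k, r)), size (ch (k, r)) = m k &
     forall r', r' \in ch (k, r) -> [/\ r' != r,
      `|ratr r' - ratr r| <= radius tau (Q k) / 4 & denq r' <= (Q k.+1)%:Z]].
  by move=> rF; exact: chP (k, r) (FQ _ _ rF).
have sizeF k : size (F k.+1) = (m k * size (F k))%N.
  rewrite /= size_flatten /shape -map_comp.
  have /eq_in_map -> : {in F k, size \o (fun r => ch (k, r)) =1 fun=> m k}.
    by move=> r rF /=; have [] := chF _ _ rF.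
  by elim: (F k) => [|a s IHs] /=; rewrite ?muln0// IHs mulnS.
have size_gt0 k : (0 < size (F k))%N.
  elim: k => // k IH; rewrite sizeF muln_gt0 IH andbT lt0n; apply/eqP => e.
  by have := mr k; rewrite e mul0r; lra.
exists Q, F; split.
- by [].
- by [].
- exact: Q0.
- exact: rQ.
- elim=> // k IH /=; apply: uniq_flatten_map => //.
  + by move=> r rF; have [] := chF _ _ rF.
  (* Two parents sharing a child would be at most half a radius apart, less than their separation
     [Q_k^-2]. *)
  + move=> r r' rF r'F rr'; apply/hasPn => z zr'; apply/negP => /= zr.
    have [_ _ /(_ _ zr)[_ h _]] := chF _ _ rF.
    have [_ _ /(_ _ zr')[_ h' _]] := chF _ _ r'F.
    have := rat_separation R rr' (FQ _ _ rF) (FQ _ _ r'F).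
    apply/negP; rewrite -ltNge -expr2.
    have d : `|ratr r - ratr r'| <= radius tau (Q k) / 2.
      rewrite -(subrKA (ratr z)) (le_trans (ler_normD _ _))//.
      by rewrite distrC; lra.
    apply: (@le_lt_trans _ _ (radius tau (Q k) / 2 * (Q k)%:R ^+ 2)).
      by rewrite ler_wpM2r// sqr_ge0.
    by rewrite mulrAC; have := radius_sqr_le1 t2 (Q0 k); lra.
- exact: FQ.
(* A child with denominator at most [Q k] would be at least [Q_k^-2] away from its parent, but it
   lies within a quarter radius. *)
- move=> k r /= /flattenP[_ /mapP[r0 r0F ->]] rch.
  have [_ _ /(_ _ rch)[rr0 h _]] := chF _ _ r0F.
  rewrite ltNge; apply/negP => rQk.
  have := rat_separation R rr0 rQk (FQ _ _ r0F).
  apply/negP; rewrite -ltNge -expr2.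
  apply: (@le_lt_trans _ _ (radius tau (Q k) / 4 * (Q k)%:R ^+ 2)).
    by rewrite ler_wpM2r// sqr_ge0.
  by rewrite mulrAC; have := radius_sqr_le1 t2 (Q0 k); lra.
- move=> k r' /= /flattenP[_ /mapP[r0 r0F ->]] rch.
  by have [_ _ /(_ _ rch)[_ h _]] := chF _ _ r0F; exists r0.
- case=> [|k]; first by rewrite radius1 powR1 mulr1.
  apply: (le_trans (mr k)); rewrite ler_wpM2r ?powR_ge0// ler_nat sizeF.
  by rewrite leq_pmulr.
- move=> k; have /andP[h _] := mQ k.
  rewrite sizeF natrM mulrA -mulrA [leRHS]mulrC; apply: ler_wpM2l; first exact: ler0n.
  by lra.
(* A child within [e] of [c] has its parent within [e] plus a quarter radius, and each such parent
   contributes at most [m k] children. *)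
- move=> k c e; rewrite sizeF (mulnAC (m k)) leq_mul2r; apply/orP; right.
  rewrite count_flatten -map_comp /=.
  suff gen : forall s, {subset s <= F k} ->
      (sumn [seq count (close_to c e) (ch (k, r)) | r <- s] <=
       m k * count (close_to c (e + radius tau (Q k) / 4)) s)%N by exact: gen.
  elim=> [_|r s IH sF] /=; first by rewrite muln0.
 rewrite mulnDr leq_add//; last first.
    by apply: IH => z zs; apply: sF; rewrite inE zs orbT.
  have [_ sch h] := chF _ _ (sF _ (mem_head _ _)).
  have [h0|] := boolP (close_to c _ r).
    by rewrite muln1 -sch count_size.
  rewrite /close_to -ltNge => h0; rewrite muln0.
  rewrite leqNgt -has_count.
  apply/hasPn => z zch; have [_ h1 _] := h _ zch.
  rewrite -ltNge; have := ler_normD (ratr r - ratr z) (ratr z - c).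
  by rewrite subrKA (distrC (ratr r) (ratr z)); lra.
Qed.

(** Compactness of the cube of half-side [B]; the cluster point is approached at arbitrarily late
    indices. *)
Lemma bounded_rows_cluster (R : realType) (d : nat) (c : nat -> 'rV[R]_d) (B : R) :
  (forall n i, `|c n ord0 i| <= B) ->
  exists p : 'rV[R]_d, forall (eta : R) (M : nat), 0 < eta ->
    exists2 m, (M <= m)%N & forall i, `|c m ord0 i - p ord0 i| < eta.
Proof.
move=> cB.
have cpt : compact [set v : 'rV[R]_d | forall i, `[- B, B]%classic (v ord0 i)].
  by apply: (@rV_compact _ _ (fun=> `[- B, B]%classic)) => i; exact: segment_compact.
have [] := cpt (c @ \oo).
  by exists 0%N => // n _ i /=; rewrite in_itv /= -ler_norml.
move=> p [_ cl]; exists p => eta M eta0.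
have [||y [[m /= Mm <-] [_ pm]]] := cl (c @` [set m | (M <= m)%N]) (ball p eta).
- by exists M => //= m Mm; exists m.
- exact: nbhsx_ballx.
exists m => // i; have := pm ord0 i.
by rewrite /ball /= distrC.
Qed.

(** * Ancestors and counting in a Cantor scheme *)

Section Scheme.
Context {R : realType} (tau u : R) (Q : nat -> nat) (F : nat -> seq rat).
Context (scheme : cantor_scheme tau u Q F).
Context (tau2 : 2 <= tau) (u0 : 0 < u) (tauu : tau * u < 2).

Local Notation rho k := (radius tau (Q k)).
Local Notation N k := (size (F k)).

Let rho_gt0 k : 0 < rho k.
Proof. by apply: radius_gt0; exact: scheme_Q_gt0 scheme k. Qed.

Let N_gt0 k : (0 < N k)%N.
Proof.
rewrite lt0n; apply/eqP => e; have := scheme_mass scheme k.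
by rewrite e mul0r; lra.
Qed.

Lemma scheme_radius_le_exp k : rho k <= 2^-1 ^+ k.
Proof.
elim: k => [|k IH]; first by rewrite (scheme_Q0 scheme) radius1 expr0.
by apply: (le_trans (scheme_radius scheme k)); rewrite exprSr; lra.
Qed.

(** The steps to successive parents telescope: since radii at least halve,
    [rho k / 4 <= (rho k - rho k.+1) / 2]. *)
Lemma scheme_ancestor k l r : (k <= l)%N -> r \in F l ->
  exists2 r0, r0 \in F k & `|ratr r - ratr r0| <= (rho k - rho l) / 2.
Proof.
elim: l r => [|l IH] r.
  by rewrite leqn0 => /eqP -> rF; exists r => //; rewrite !subrr normr0 mul0r.
rewrite leq_eqVlt => /orP[/eqP -> rF|].
  by exists r => //; rewrite !subrr normr0 mul0r.
rewrite ltnS => kl /(scheme_parent scheme)[r1 r1F h1].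
have [r0 r0F h0] := IH _ kl r1F; exists r0 => //.
have := ler_normD (ratr r - ratr r1 : R) (ratr r1 - ratr r0); rewrite subrKA.
by have := scheme_radius scheme l; lra.
Qed.

Lemma scheme_Q_lt_denq k l r : (k < l)%N -> r \in F l -> (Q k)%:Z < denq r.
Proof.
elim: l r => // l IH r; rewrite ltnS leq_eqVlt => /orP[/eqP ->|kl] rF.
  exact: (scheme_denq_gt scheme) rF.
have [r1 r1F] : exists r1, r1 \in F l.
  by have := N_gt0 l; case: (F l) => // a s _; exists a; rewrite mem_head.
apply: (lt_trans (IH _ kl r1F)); apply: (le_lt_trans (scheme_denq_le scheme r1F)).
exact: (scheme_denq_gt scheme) rF.
Qed.

Lemma count_close_to_le (s : seq rat) (c e e' : R) : e <= e' ->
  (count (close_to c e) s <= count (close_to c e') s)%N.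
Proof. by move=> ee'; apply: sub_count => r /le_trans; apply. Qed.

(** Iterates [scheme_count]; the enlargements of the window telescope as in [scheme_ancestor]. *)
Lemma scheme_count_iter j n (c e : R) :
  (count (close_to c e) (F (j + n)) * N j <=
   N (j + n) * count (close_to c (e + (rho j - rho (j + n)) / 2)) (F j))%N.
Proof.
elim: n e => [|n IH] e.
  by rewrite addn0 subrr mul0r addr0 mulnC.
rewrite addnS; set l := (j + n)%N in IH *.
rewrite -(leq_pmul2r (N_gt0 l)) mulnAC.
apply: (@leq_trans (N l.+1 * (count (close_to c (e + rho l / 4)) (F l) * N j))%N).
  by rewrite mulnA leq_mul2r (scheme_count scheme) orbT.
rewrite -[leqRHS]mulnA leq_mul2l; apply/orP; right.
apply: (leq_trans (IH _)); rewrite mulnC leq_mul2r; apply/orP; right.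
apply: count_close_to_le.
by have := scheme_radius scheme l; lra.
Qed.

(** The Frostman-type estimate. For [e < 1] take the first level [j + 1] with radius at most [e].
    The proportion at level [k] is at most that of level [j + 1] in a window of radius [3 e / 2],
    where separation leaves at most [3 e Q^2 + 1] centres, with [Q] the bound of level [j + 1]. Both
    [1] and [e Q^2 / 800] are at most [e^u N], with [N] the size of that level, whence
    [2401 = 3 * 800 + 1]. *)
Lemma scheme_count_le k (c e : R) : rho k <= e ->
  (count (close_to c e) (F k))%:R <= 2401 * ((N k)%:R * e `^ u).
Proof.
move=> ke; have e0 : 0 < e by exact: lt_le_trans ke.
have eu0 : 0 <= e `^ u by exact: powR_ge0.
have u1 : u < 1 by move: tau2 u0 tauu; nra.
have [e1|e1] := leP 1 e.
  have h : 1 <= e `^ u by rewrite -(powRr0 e) ler_powR// ltW.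
  have h2 : (count (close_to c e) (F k))%:R <= (N k)%:R * e `^ u.
    apply: (@le_trans _ _ (N k)%:R); first by rewrite ler_nat count_size.
    by rewrite ler_peMr.
  have : 0 <= (N k)%:R * e `^ u by rewrite mulr_ge0.
  by move: h2; lra.
have ex : exists j, rho j <= e by exists k.
case: (ex_minnP ex) => j je jmin.
have jk : (j <= k)%N by exact: jmin.
case: j je jmin jk => [|j] je jmin jk.
  by move: je; rewrite (scheme_Q0 scheme) radius1; lra.
have je' : e < rho j by rewrite ltNge; apply/negP => /jmin; rewrite ltnn.
have cnt : (count (close_to c e) (F k))%:R * (N j.+1)%:R <=
    (N k)%:R * (3 * e * (Q j.+1)%:R ^+ 2 + 1) :> R.
  have := scheme_count_iter j.+1 (k - j.+1) c e; rewrite subnKC// => h.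
  rewrite -natrM; apply: le_trans (_ : (N k * count (close_to c (3 / 2 * e)) (F j.+1))%N%:R <= _).
    rewrite ler_nat (leq_trans h)// leq_mul2l; apply/orP; right.
    by apply: count_close_to_le; have := rho_gt0 k; lra.
  rewrite natrM ler_wpM2l//.
  have := @count_separated R (F j.+1) (Q j.+1) c (3 / 2 * e) (scheme_uniq scheme _)
    (@scheme_denq_le _ _ _ _ _ scheme _).
  have -> : 2 * (3 / 2 * e) = 3 * e by field.
  by apply; rewrite mulr_ge0 ?ltW//; lra.
rewrite -(ler_pM2r (_ : 0 < (N j.+1)%:R)) ?ltr0n//; apply: (le_trans cnt).
rewrite [leRHS](_ : _ = (N k)%:R * (2401 * (e `^ u * (N j.+1)%:R))); last by ring.
rewrite ler_wpM2l//.
have h1 : 1 <= e `^ u * (N j.+1)%:R.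
  apply: (le_trans (scheme_mass scheme j.+1)); rewrite mulrC ler_wpM2r//.
  by rewrite ge0_ler_powR ?nnegrE ?(ltW u0) ?(ltW e0) ?(ltW (rho_gt0 _)).
(* Write [e = e^u e^(1 - u)]; as [e < rho j] and [u < 1], the second factor is at most
   [rho_j^(1 - u)], hence at most [N_j rho_j] by the mass bound. *)
have h2 : e * (Q j.+1)%:R ^+ 2 <= 800 * (e `^ u * (N j.+1)%:R).
  have split_pow (z : R) : 0 < z -> z = z `^ u * z `^ (1 - u).
    move=> z0; rewrite -powRD; last by rewrite lt0r_neq0 ?implybT.
    by rewrite (_ : u + (1 - u) = 1) ?powRr1 ?ltW//; ring.
  have eE := split_pow _ e0; have rE := split_pow _ (rho_gt0 j).
  have ele : e `^ (1 - u) <= rho j `^ (1 - u).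
    by rewrite ge0_ler_powR ?nnegrE ?(ltW e0) ?(ltW (rho_gt0 _)) ?(ltW je')//; lra.
  have rle : rho j `^ (1 - u) <= (N j)%:R * rho j.
    rewrite {2}rE mulrA ler_peMl ?powR_ge0//.
    exact: scheme_mass scheme j.
  rewrite {1}eE -mulrA [leRHS]mulrCA; apply: ler_wpM2l => //.
  apply: le_trans (scheme_size scheme j).
  by rewrite ler_wpM2r ?sqr_ge0// (le_trans ele).
by move: h1 h2; set a := e * _; set b := _ * (N j.+1)%:R; rewrite -mulrA -/a; lra.
Qed.

End Scheme.

(* Centres of finer levels lie within half the radius of a centre of level [k]
   (see [scheme_ancestor]); the factor [3 / 4] leaves room for limits of such
   centres. *)
Definition cantor_set {R : realType} (tau : R) (Q : nat -> nat)
    (F : nat -> seq rat) {d : nat} : set 'rV[R]_d :=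
  [set y | forall k i, exists2 r, r \in F k &
    `|y ord0 i - ratr r| <= 3 / 4 * radius tau (Q k)].

(** * The Cantor set and its covers *)

Section CantorSet.
Context {R : realType} (tau u : R) (Q : nat -> nat) (F : nat -> seq rat).
Context (scheme : cantor_scheme tau u Q F).
Context (tau2 : 2 <= tau) (u0 : 0 < u) (tauu : tau * u < 2).

Local Notation rho k := (radius tau (Q k)).
Local Notation N k := (size (F k)).

Let rho_gt0 k : 0 < rho k.
Proof. by apply: radius_gt0; exact: scheme_Q_gt0 scheme k. Qed.

(** Each level supplies one rational row near the point, and rows of different levels differ because
    their first entries have different denominators. *)
Lemma cantor_set_sub (d : nat) : (0 < d)%N ->
  @cantor_set R tau Q F d `<=` S_ theta_max tau.
Proof.
move=> d0 y yK; rewrite /S_ /=.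
have /choice[c cP] : forall ki : nat * 'I_d, exists r, r \in F ki.1 /\
    `|y ord0 ki.2 - ratr r| <= 3 / 4 * rho ki.1.
  by move=> [k i]; have [r rF h] := yK k i; exists r.
pose v k : 'rV[rat]_d := \row_i c (k, i).
pose i0 : 'I_d := Ordinal d0.
have vinj : injective v.
  have lt k l : (k < l)%N -> v k <> v l.
    move=> kl /rowP/(_ i0); rewrite !mxE => e.
    have [h1 _] := cP (k, i0); have [h2 _] := cP (l, i0).
    have := scheme_Q_lt_denq scheme kl h2.
    by rewrite ltNge -e (scheme_denq_le scheme h1).
  move=> k l e; case: (ltngtP k l) => // [/lt|/lt] []; exact/esym.
move=> fin; apply: infinite_nat.
have finv := finite_preimage (fun k l _ _ => @vinj k l) fin.
apply: sub_finite_set finv => k _ i /=.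
have [ckF ck] := cP (k, i); rewrite mxE; apply: (le_lt_trans ck).
have den1 (r : rat) : (0 < `|denq r|)%N by rewrite absz_gt0 denq_neq0.
apply: (@lt_le_trans _ _ (rho k)); first by rewrite /=; have := rho_gt0 k; lra.
rewrite -[leRHS]/(radius tau (\max_(j < d) denominators (v k) j)).
have tau0 : 0 <= tau by exact: le_trans tau2.
apply: radius_le => //.
- by apply: leq_trans (den1 (v k ord0 i0)) _; exact: (leq_bigmax i0).
- apply/bigmax_leqP => j _; rewrite /denominators mxE.
  have [h _] := cP (k, j); have := scheme_denq_le scheme h.
  by rewrite -[X in X <= _]absz_denq lez_nat.
Qed.

(** Compactness: otherwise, for every [m], some row of centres of level at least [m] avoids the
    first [m] boxes. A cluster point of these rows lies in the Cantor set, hence in some open box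
    [n], which then contains a row with [m > n]. *)
Lemma cantor_finite_cover (d : nat) (x : nat -> 'rV[R]_d) (rad : nat -> R) :
  cantor_set tau Q F `<=`
    \bigcup_n [set y : 'rV[R]_d | forall i, `|y ord0 i - x n ord0 i| < rad n] ->
  exists n0 k0, forall k, (k0 <= k)%N -> forall c : 'rV[rat]_d,
    (forall i, c ord0 i \in F k) ->
    exists2 n, (n < n0)%N & forall i, `|ratr (c ord0 i) - x n ord0 i| < rad n.
Proof.
move=> cover; apply: contrapT => nex.
have /choice[kc kcP] : forall m : nat, exists kc : nat * 'rV[rat]_d,
    [/\ (m <= kc.1)%N, forall i, kc.2 ord0 i \in F kc.1 &
     forall n, (n < m)%N -> ~ forall i, `|ratr (kc.2 ord0 i) - x n ord0 i| < rad n].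
  move=> m; apply: contrapT => nkc; apply: nex; exists m, m => k mk c cF.
  apply: contrapT => nn; apply: nkc; exists (k, c); split => // n nm h.
  by apply: nn; exists n.
pose v m : 'rV[R]_d := \row_i ratr ((kc m).2 ord0 i).
have [|p pP] := @bounded_rows_cluster R d v 1.
  move=> m i; rewrite mxE; have [_ h _] := kcP m.
  have [r0] := scheme_ancestor scheme (leq0n _) (h i).
  rewrite (scheme_F0 scheme) inE => /eqP ->; rewrite rmorph0 subr0.
  rewrite (scheme_Q0 scheme) radius1 => /le_trans; apply.
  by have := rho_gt0 (kc m).1; lra.
have [n _ /= pn] : (\bigcup_n [set y : 'rV[R]_d |
    forall i, `|y ord0 i - x n ord0 i| < rad n]) p.
  apply: cover => k i; have rk := rho_gt0 k.
  (* A quarter radius from the limit plus half a radius from [scheme_ancestor] gives the [3 / 4] of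
     [cantor_set]. *)
  have [|m km h] := pP (rho k / 4) k; first by lra.
  have [mk cF _] := kcP m.
  have [r rF rh] := scheme_ancestor scheme (leq_trans km mk) (cF i).
  exists r => //; have := h i; rewrite mxE distrC => hi.
  move: hi rh; set a := ratr (_ ord0 i).
  have := ler_normD (p ord0 i - a) (a - ratr r).
  by rewrite subrKA; have := rho_gt0 (kc m).1; lra.
have [eta eta0 etaP] : exists2 eta, 0 < eta &
    forall i, `|p ord0 i - x n ord0 i| + eta <= rad n.
  exists (\big[Num.min/1]_i (rad n - `|p ord0 i - x n ord0 i|)).
    by apply: lt_bigmin => // i _; rewrite subr_gt0.
  by move=> i; rewrite -lerBrDl; exact: bigmin_le.
have [m nm h] := pP eta n.+1 eta0.
have [_ _ /(_ n nm)] := kcP m; apply => i.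
have := h i; have := etaP i; rewrite mxE.
set a := ratr _; have := ler_normD (a - p ord0 i) (p ord0 i - x n ord0 i).
by rewrite subrKA; lra.
Qed.

(** Mass distribution at one level finer than all [n0] boxes: every one of the [N^d] rows of centres
    lies in a box, and box [n] holds at most [(2401 N rad_n^u)^d] of them by [scheme_count_le] in
    each coordinate. *)
Lemma cantor_cover_mass (d : nat) (x : nat -> 'rV[R]_d) (rad : nat -> R) :
  (forall n, 0 < rad n) ->
  cantor_set tau Q F `<=`
    \bigcup_n [set y : 'rV[R]_d | forall i, `|y ord0 i - x n ord0 i| < rad n] ->
  exists n0, 1 <= 2401 ^+ d * \sum_(n < n0) rad n `^ (u * d%:R).
Proof.
move=> rad0 /cantor_finite_cover[n0 [k0 k0P]]; exists n0.
have [k kk0 krad] : exists2 k, (k0 <= k)%N & forall n : 'I_n0, rho k <= rad n.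
  pose e := \big[Num.min/1]_(n < n0) rad n.
  have e0 : 0 < e by apply: lt_bigmin.
  have [k ke] : exists k, 2^-1 ^+ k < e.
    pose n := (Num.trunc e^-1).+1; exists n.
    have ne : e^-1 < n%:R by exact: truncnS_gt.
    rewrite exprVn invf_plt ?posrE ?exprn_gt0// (lt_trans ne)//.
    by rewrite -natrX ltr_nat ltn_expl.
  exists (k0 + k)%N; first exact: leq_addr.
  move=> n; apply: (@le_trans _ _ e); last exact: bigmin_le.
  apply: (le_trans (scheme_radius_le_exp scheme _)); apply: ltW; apply: le_lt_trans ke.
  by rewrite exprD ler_piMl ?exprn_ge0// ?exprn_ile1//; lra.
have Nk0 : 0 < (N k)%:R :> R.
  by have := scheme_mass scheme k; case: (N k) => [|m _]; rewrite ?mul0r ?ltr0n//; lra.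
pose f n (i : 'I_d) (a : 'I_(N k)) : R :=
  (close_to (x n ord0 i) (rad n) (nth 0 (F k) a))%:R.
have fsum n i : \sum_a f n i a = (count (close_to (x n ord0 i) (rad n)) (F k))%:R.
  rewrite -sum1_count (big_nth 0) big_mkord natr_sum [RHS]big_mkcond /=.
  by apply: eq_bigr => a _; rewrite /f; case: ifP.
have total : \sum_(g : {ffun 'I_d -> 'I_(N k)}) (1 : R) = (N k)%:R ^+ d.
  by rewrite sumr_const card_ffun !card_ord natrX.
have : (N k)%:R ^+ d <= \sum_(n < n0) \prod_i \sum_a f n i a.
  rewrite -total; under [leRHS]eq_bigr => n _ do rewrite bigA_distr_bigA.
  rewrite exchange_big /=; apply: ler_sum => g _.
  have [|n nn0 h] := k0P k kk0 (\row_i nth 0 (F k) (g i)).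
    by move=> i; rewrite mxE mem_nth.
  rewrite (bigD1 (Ordinal nn0))//= ler_wpDr//.
    by rewrite sumr_ge0// => ? _; rewrite prodr_ge0// => ? _.
  rewrite big1 // => i _; rewrite /f /close_to ltW//.
  by have := h i; rewrite mxE.
move=> /le_trans h.
have {h} : (N k)%:R ^+ d <= \sum_(n < n0) (2401 * ((N k)%:R * rad n `^ u)) ^+ d.
  apply: h; apply: ler_sum => n _.
  rewrite -[d in leRHS]card_ord -prodr_const; apply: ler_prod => i _.
  rewrite fsum; apply/andP; split; first exact: ler0n.
  exact: (scheme_count_le scheme tau2 u0 tauu).
have -> : \sum_(n < n0) (2401 * ((N k)%:R * rad n `^ u)) ^+ d =
    (2401 ^+ d * \sum_(n < n0) rad n `^ (u * d%:R)) * (N k)%:R ^+ d.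
  rewrite mulrAC mulr_sumr; apply: eq_bigr => n _.
  by rewrite !exprMn powRrM powR_mulrn ?powR_ge0// mulrA.
by rewrite -[leLHS]mul1r; rewrite (ler_pM2r (exprn_gt0 d Nk0)).
Qed.

End CantorSet.

(** * The lower bound *)

Section EuclideanDiameter.
Context {R : realType} {d : nat}.
Implicit Types (x y : 'rV[R]_d) (U : set 'rV[R]_d).

Lemma coord_le_euclidean_dist x y i :
  `|x ord0 i - y ord0 i| <= euclidean_dist x y.
Proof.
rewrite -sqrtr_sqr ler_sqrt; last by apply: sumr_ge0 => j _; exact: sqr_ge0.
by rewrite (bigD1 i)//= lerDl sumr_ge0// => j _; exact: sqr_ge0.
Qed.

Lemma euclidean_dist_le x y (e : R) : 0 <= e ->
  (forall i, `|x ord0 i - y ord0 i| <= e) -> euclidean_dist x y <= d%:R * e.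
Proof.
move=> e0 xy; have de0 : 0 <= d%:R * e by rewrite mulr_ge0.
rewrite -(ger0_norm de0) -sqrtr_sqr ler_sqrt ?sqr_ge0//.
apply: (@le_trans _ _ (\sum_(i < d) e ^+ 2)).
  by apply: ler_sum => i _; rewrite -[X in X <= _]real_normK ?num_real// lerXn2r ?nnegrE.
rewrite sumr_const card_ord -[leLHS]mulr_natl exprMn ler_wpM2r ?sqr_ge0//.
by rewrite -natrX ler_nat; case: d => // n; rewrite expnS leq_pmulr// expn_gt0.
Qed.

Lemma diameter_ge0 U : U !=set0 -> (0%:E <= diameter euclidean_dist U)%E.
Proof.
move=> [x Ux]; apply: ereal_sup_ubound; exists x, x; split => //.
rewrite /euclidean_dist big1 ?sqrtr0// => i _.
by rewrite subrr expr0n.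
Qed.

Lemma diameterP U (delta : R) : U !=set0 ->
  (diameter euclidean_dist U <= delta%:E)%E ->
  exists D : R, [/\ diameter euclidean_dist U = D%:E, 0 <= D, D <= delta &
    forall x y, U x -> U y -> euclidean_dist x y <= D].
Proof.
move=> U0 Ud; have := diameter_ge0 U0.
have sup x y : U x -> U y -> ((euclidean_dist x y)%:E <= diameter euclidean_dist U)%E.
  by move=> Ux Uy; apply: ereal_sup_ubound; exists x, y.
move: Ud sup; case: (diameter _ _) => // D; rewrite lee_fin => Dd sup D0.
by exists D; split => // x y Ux Uy; have := sup _ _ Ux Uy; rewrite lee_fin.
Qed.

End EuclideanDiameter.

Lemma sum_half_pow_le1 (R : realFieldType) (n : nat) :
  \sum_(i < n) 2^-1 ^+ i.+1 <= 1 :> R.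
Proof.
suff -> : \sum_(i < n) 2^-1 ^+ i.+1 = 1 - 2^-1 ^+ n :> R.
  by rewrite gerBl exprn_ge0// invr_ge0.
elim: n => [|n IH]; first by rewrite big_ord0 expr0 subrr.
by rewrite big_ord_recr /= IH exprSr; field.
Qed.

(** The sum is at most twice the larger of [2 D] and [t]. This holds for every exponent, whereas
    [powR] is not subadditive for exponents above 1. *)
Lemma powR_affine_le (R : realType) (D t s : R) : 0 <= D -> 0 <= t -> 0 <= s ->
  (2 * D + t) `^ s <= 4 `^ s * D `^ s + (2 * t) `^ s.
Proof.
move=> D0 t0 s0.
have h4 : 0 <= 4 `^ s * D `^ s by rewrite mulr_ge0 ?powR_ge0.
have h2 : 0 <= (2 * t) `^ s by rewrite powR_ge0.
have [tD|Dt] := leP t (2 * D).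
  apply: (@le_trans _ _ ((4 * D) `^ s)); last by rewrite powRM// lerDl.
  by rewrite ge0_ler_powR ?nnegrE//; lra.
apply: (@le_trans _ _ ((2 * t) `^ s)); last by rewrite lerDr.
by rewrite ge0_ler_powR ?nnegrE//; lra.
Qed.

Lemma hausdorff_measure_gt0 (R : realType) (d : nat) (tau s : R)
    (A : set 'rV[R]_d) :
  (0 < d)%N -> 2 <= tau -> 0 <= s -> s < 2 * d%:R / tau ->
  S_ theta_max tau `<=` A -> (0 < hausdorff_measure euclidean_dist s A)%E.
Proof.
move=> d0 tau2 s0 stau SA.
have dR : 0 < d%:R :> R by rewrite ltr0n.
have tau0 : 0 < tau by lra.
(* [u] is the midpoint of [s / d] and [2 / tau]. *)
have [u [u0 tauu su]] : exists u, [/\ 0 < u, tau * u < 2 & s <= u * d%:R].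
  exists ((s / d%:R + 2 / tau) / 2).
  have h1 : s / d%:R < 2 / tau.
    by rewrite ltr_pdivrMr// mulrAC.
  have h0 : 0 <= s / d%:R by rewrite divr_ge0// ltW.
  split.
  - lra.
  - have : (s / d%:R + 2 / tau) / 2 < 2 / tau by lra.
    by rewrite ltr_pdivlMr// mulrC.
  - by rewrite -ler_pdivrMr//; lra.
have [Q [F scheme]] := cantor_scheme_exists tau2 u0 tauu.
pose s' := u * d%:R; have s'0 : 0 < s' by rewrite mulr_gt0.
pose C : R := 2401 ^+ d; have C0 : 0 < C by apply: exprn_gt0; exact: ltr0Sn.
pose eta := (2 * C)^-1; have eta0 : 0 < eta by rewrite invr_gt0 mulr_gt0.
pose c0 := eta / 4 `^ s'; have c00 : 0 < c0 by rewrite divr_gt0// powR_gt0.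
apply: (@lt_le_trans _ _ c0%:E); first by rewrite lte_fin.
apply: le_ereal_sup_tmp.
(* Scale 1 is enough: diameters at most 1 satisfy [D^s' <= D^s], as [s <= s']. *)
exists (hausdorff_premeasure euclidean_dist s 1 A); first by exists 1; [exact: ltr01|].
apply: le_ereal_inf_tmp => _ [U [AU Udiam] <-].
pose x n := xget 0 (U n).
pose D n := if U n == set0 then 0 else fine (diameter euclidean_dist (U n)).
have DP n : [/\ 0 <= D n, forall y i, U n y -> `|y ord0 i - x n ord0 i| <= D n &
    ((D n `^ s')%:E <= gauge euclidean_dist s (U n))%E].
  rewrite /D /gauge; case: ifPn => [/eqP ->|/set0P U0].
    by split => //; rewrite powR0// gt_eqF.
  have [D' [-> D0 D1 D'P]] := diameterP U0 (Udiam n).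
  split => //=.
    move=> y i Uy; apply: (le_trans (coord_le_euclidean_dist _ _ _)).
    by apply: D'P => //; exact: xgetPex.
  rewrite lee_fin; move: D0; rewrite le_eqVlt => /orP[/eqP <-|D0].
    by rewrite powR0 ?gt_eqF// powR_ge0.
  by apply: ger_powR => //; rewrite D0.
(* Covering sets may have diameter 0, so the boxes are fattened by [t n]. The total cost of this
   slack is at most [eta], half of the lower bound [1 / C = 2 eta] from [cantor_cover_mass]. *)
pose t n := (eta * 2^-1 ^+ n.+1) `^ s'^-1 / 2.
have b0 n : 0 < eta * 2^-1 ^+ n.+1 by rewrite mulr_gt0// exprn_gt0.
have t0 n : 0 < t n by rewrite divr_gt0// powR_gt0.
have tE n : (2 * t n) `^ s' = eta * 2^-1 ^+ n.+1.
  by rewrite mulrCA mulfV// mulr1 -powRrM mulVf ?gt_eqF// powRr1// ltW.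
pose rad n := 2 * D n + t n.
have rad0 n : 0 < rad n.
  by have [h _ _] := DP n; rewrite /rad; have := t0 n; lra.
have [|n0] := cantor_cover_mass scheme tau2 u0 tauu (x := x) rad0.
  move=> y /(cantor_set_sub scheme tau2 d0)/SA/AU[n _ Uy]; exists n => // i.
  have [h h1 _] := DP n; apply: (le_lt_trans (h1 _ _ Uy)).
  by rewrite /rad; have := t0 n; lra.
rewrite -/s' -/C => mass.
apply: (@le_trans _ _ (\sum_(0 <= n < n0) gauge euclidean_dist s (U n))%E); last first.
  apply: nneseries_lim_ge => n _ _; have [_ _] := DP n; apply: le_trans.
  by rewrite lee_fin powR_ge0.
apply: (@le_trans _ _ (\sum_(0 <= n < n0) (D n `^ s')%:E)%E); last first.
  by apply: lee_sum => n _; have [] := DP n.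
rewrite sumEFin lee_fin big_mkord.
have : \sum_(n < n0) rad n `^ s' <=
    4 `^ s' * (\sum_(n < n0) D n `^ s') + eta * \sum_(n < n0) 2^-1 ^+ n.+1.
  rewrite !mulr_sumr -big_split /=; apply: ler_sum => n _.
  rewrite -tE; apply: powR_affine_le; [by have [] := DP n|exact: ltW|exact: ltW].
have : eta * \sum_(n < n0) 2^-1 ^+ n.+1 <= eta.
  by rewrite ler_piMr ?(ltW eta0)// sum_half_pow_le1.
have : 2 * eta <= \sum_(n < n0) rad n `^ s'.
  by move: mass; rewrite -ler_pdivrMl// mulr1 /eta invfM mulrA mulfV// mul1r.
move=> h1 h2 h3; rewrite /c0 ler_pdivrMr ?powR_gt0// mulrC.
by move: h1 h2 h3; clear; lra.
Qed.

Lemma hausdorff_dim_ge (R : realType) (d : nat) (tau : R) (A : set 'rV[R]_d) :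
  (0 < d)%N -> 2 <= tau -> S_ theta_max tau `<=` A ->
  ((2 * d%:R / tau)%:E <= hausdorff_dim euclidean_dist A)%E.
Proof.
move=> d0 tau2 SA; apply: le_ereal_inf_tmp => _ [s [s0 Hs] <-].
rewrite lee_fin leNgt; apply/negP => stau.
by have := hausdorff_measure_gt0 d0 tau2 s0 stau SA; rewrite Hs ltxx.
Qed.

(** * The upper bound *)

(** Cauchy condensation: the block from [2^j] to [2^(j+1)] has [2^j] terms, each at most
    [2^(- kappa j)]. *)
Lemma sum_powRN_dyadic_le (R : realType) (kappa : R) (k : nat) : 0 <= kappa ->
  \sum_(1 <= n < 2 ^ k) n%:R `^ (- kappa) <=
  \sum_(j < k) (2 `^ (1 - kappa)) ^+ j.
Proof.
move=> k0; elim: k => [|k IH]; first by rewrite expn0 big_geq// big_ord0.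
have h1 : (1 <= 2 ^ k)%N by rewrite expn_gt0.
rewrite big_ord_recr /= (big_cat_nat h1) ?leq_exp2l//=; apply: lerD => //.
have -> : (2 `^ (1 - kappa)) ^+ k = \sum_(2 ^ k <= n < 2 ^ k.+1) (2 ^ k)%:R `^ (- kappa) :> R.
  rewrite sumr_const_nat expnS mul2n -addnn addnK -powR_mulrn ?powR_ge0// -powRrM.
  rewrite mulrBl mul1r powRD; last by rewrite pnatr_eq0 implybT.
  rewrite powR_mulrn// -[RHS]mulr_natl !natrX; congr (_ * _).
  by rewrite -powR_mulrn// -powRrM mulrN mulrC.
rewrite big_nat [leRHS]big_nat; apply: ler_sum => n /andP[kn _].
rewrite !powRN lef_pV2 ?posrE ?powR_gt0 ?ltr0n ?expn_gt0 ?(leq_trans _ kn)//.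
by rewrite ge0_ler_powR ?nnegrE// ler_nat.
Qed.

Lemma sum_powRN_bounded (R : realType) (kappa : R) : 1 < kappa ->
  exists2 Z : R, 0 <= Z & forall N, \sum_(n < N) n.+1%:R `^ (- kappa) <= Z.
Proof.
move=> k1; set x := 2 `^ (1 - kappa).
have x0 : 0 < x by rewrite powR_gt0.
have x1 : x < 1.
  rewrite /x (_ : 1 - kappa = - (kappa - 1)) ?powRN; last by ring.
  rewrite invf_lt1 ?powR_gt0//.
  have : 1 `^ (kappa - 1) < 2 `^ (kappa - 1) :> R.
    by rewrite gt0_ltr_powR ?nnegrE//; lra.
  by rewrite powR1.
exists (1 - x)^-1; first by rewrite invr_ge0; lra.
move=> N.
have geo k : \sum_(j < k) x ^+ j <= (1 - x)^-1.
  rewrite -[leRHS]mul1r ler_pdivlMr; last by lra.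
  rewrite (_ : _ * (1 - x) = 1 - x ^+ k); last first.
    elim: k => [|k IH]; first by rewrite big_ord0 mul0r expr0 subrr.
    by rewrite big_ord_recr /= mulrDl IH exprSr; ring.
  by rewrite gerBl exprn_ge0// ltW.
apply: le_trans (geo N.+1); apply: le_trans (sum_powRN_dyadic_le _ _); last by lra.
have NN : (N.+1 <= 2 ^ N.+1)%N by rewrite ltnW// ltn_expl.
rewrite (big_cat_nat _ NN)//= big_add1 big_mkord lerDl.
by rewrite sumr_ge0// => n _; rewrite powR_ge0.
Qed.

Lemma sum_inj_le (R : realType) (S : eqType) (T : finType) (h : S -> T)
    (s : seq S) (f : S -> R) (w : T -> R) :
  uniq s -> {in s &, injective h} -> (forall t, 0 <= w t) ->
  (forall x, x \in s -> f x <= w (h x)) -> \sum_(x <- s) f x <= \sum_t w t.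
Proof.
move=> us hinj w0 fw.
apply: (@le_trans _ _ (\sum_(t <- map h s) w t)).
  by rewrite big_map [leLHS]big_seq [leRHS]big_seq; apply: ler_sum.
rewrite big_uniq; last by rewrite map_inj_in_uniq.
by rewrite [leRHS](bigID (mem (map h s)))/= lerDl sumr_ge0.
Qed.

Lemma prod_powR (R : realType) (I : finType) (f : I -> R) (k : R) :
  (forall i, 0 <= f i) -> \prod_i f i `^ k = (\prod_i f i) `^ k.
Proof.
move=> f0; suff [] : \prod_i f i `^ k = (\prod_i f i) `^ k /\ 0 <= \prod_i f i by [].
apply: (big_rec2 (fun a b => a = b `^ k /\ 0 <= b)).
  by rewrite powR1; split.
by move=> i a b _ [-> b0]; rewrite powRM// mulr_ge0.
Qed.

(** The successor keeps the base, and so the weight, positive at the rational 0. *)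
Definition rat_weight {R : realType} (kappa : R) (r : rat) : R :=
  (`|denq r| * `|numq r|.+1)%N%:R `^ (- kappa).

(** Sign, absolute numerator and denominator determine a rational, so the sum is at most two copies
    of the square of a convergent series. Summability is phrased as a uniform bound over
    duplicate-free lists. *)
Lemma sum_rat_weight_bounded (R : realType) (kappa : R) : 1 < kappa ->
  exists2 K : R, 0 <= K &
    forall s : seq rat, uniq s -> \sum_(r <- s) rat_weight kappa r <= K.
Proof.
move=> k1; have [Z Z0 ZP] := sum_powRN_bounded k1.
exists (2 * (Z * Z)); first by rewrite mulr_ge0// mulr_ge0.
move=> s us.
pose M := \max_(r <- s) (`|numq r| + `|denq r|)%N.
have sM r : r \in s -> (`|numq r| < M.+1)%N && (`|denq r|.-1 < M.+1)%N.
  move=> rs; have : (`|numq r| + `|denq r| <= M)%N by exact: leq_bigmax_seq.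
  by move=> h; apply/andP; split; move: h; move: `|numq r|%N `|denq r|%N => a b; lia.
pose h (r : rat) : bool * ('I_M.+1 * 'I_M.+1) :=
  (numq r < 0, (inord `|numq r|, inord `|denq r|.-1)).
pose w (t : bool * ('I_M.+1 * 'I_M.+1)) : R :=
  t.2.1.+1%:R `^ (- kappa) * t.2.2.+1%:R `^ (- kappa).
have den1 (r : rat) : (`|denq r|.-1.+1 = `|denq r|)%N.
  by rewrite prednK// absz_gt0 denq_neq0.
apply: (@le_trans _ _ (\sum_t w t)).
  apply: (@sum_inj_le _ _ _ h) => //.
  - move=> r r' /sM/andP[n1 d1] /sM/andP[n1' d1'] [] sgn.
    move=> /(congr1 val) /=; rewrite !inordK// => en.
    move=> /(congr1 val) /=; rewrite !inordK// => /(congr1 succn).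
    rewrite !den1 => ed; rewrite -[r]divq_num_den -[r']divq_num_den.
    congr (_%:~R / _%:~R); last by rewrite -[LHS]absz_denq -[RHS]absz_denq ed.
    by rewrite [LHS]intEsign [RHS]intEsign sgn en.
  - by move=> t; rewrite mulr_ge0 ?powR_ge0.
  - move=> r /sM/andP[n1 d1]; rewrite /rat_weight /w /= !inordK// den1.
    by rewrite natrM powRM// mulrC.
have wb b : \sum_t w (b, t) <= Z * Z.
  rewrite -(pair_bigA _ (fun p q => w (b, (p, q)))) /= /w /=.
  rewrite -big_distrlr /=; apply: ler_pM (ZP _) (ZP _);
    by apply: sumr_ge0 => n _; exact: powR_ge0.
rewrite -(pair_bigA _ (fun b t => w (b, t))) /= big_bool /=.
by have := wb true; have := wb false; lra.
Qed.

Definition rat_row_weight {R : realType} (kappa : R) {d} (r : 'rV[rat]_d) : R :=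
  \prod_i rat_weight kappa (r ord0 i).

Lemma sum_rat_row_weight_bounded (R : realType) (kappa : R) (d : nat) : 1 < kappa ->
  exists2 K : R, 0 < K & forall s : seq 'rV[rat]_d, uniq s ->
    \sum_(r <- s) rat_row_weight kappa r <= K.
Proof.
move=> k1; have [K K0 KP] := sum_rat_weight_bounded k1.
have g0 r : 0 <= rat_weight kappa r by exact: powR_ge0.
(* [K] may be 0; adding 1 makes the bound positive, so that it can serve as a divisor later. *)
exists ((1 + K) ^+ d); first by rewrite exprn_gt0//; lra.
move=> s us.
(* All entries of all rows in [s]. The extra 0 makes the list nonempty, as indexing by [inord]
   requires. *)
pose E := undup (0 :: flatten [seq [seq r ord0 i | i <- enum 'I_d] | r : 'rV[rat]_d <- s]).
have inE' (r : 'rV[rat]_d) i : r \in s -> r ord0 i \in E.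
  move=> rs; rewrite mem_undup inE; apply/orP; right; apply/flattenP.
  exists [seq r ord0 i | i <- enum 'I_d]; first by apply/mapP; exists r.
  by apply/mapP; exists i; rewrite ?mem_enum.
have [n En] : exists n, size E = n.+1.
  have : 0 \in E by rewrite mem_undup mem_head.
  by case: (E) => // a t _; exists (size t).
pose h (r : 'rV[rat]_d) : {ffun 'I_d -> 'I_n.+1} := [ffun i => inord (index (r ord0 i) E)].
pose w (f : {ffun 'I_d -> 'I_n.+1}) := \prod_i rat_weight kappa (nth 0 E (f i)).
have nthE (r : 'rV[rat]_d) i : r \in s -> nth 0 E (h r i) = r ord0 i.
  move=> rs; rewrite ffunE inordK; last by rewrite -En index_mem inE'.
  by rewrite nth_index// inE'.
apply: (@le_trans _ _ (\sum_f w f)).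
  apply: (@sum_inj_le _ _ _ h) => //.
  - move=> r r' rs r's hh'; apply/rowP => i.
    by rewrite -(nthE _ _ rs) -(nthE _ _ r's) hh'.
  - by move=> f; apply: prodr_ge0.
  - move=> r rs; rewrite le_eqVlt; apply/orP; left; apply/eqP.
    by apply: eq_bigr => i _; rewrite nthE.
rewrite -(bigA_distr_bigA (fun=> fun a : 'I_n.+1 => rat_weight kappa (nth 0 E a))) /=.
rewrite prodr_const card_ord lerXn2r ?nnegrE//; [|lra|].
  by apply: sumr_ge0.
have := KP E (undup_uniq _); rewrite (big_nth 0) big_mkord En; lra.
Qed.

Lemma powR_unbounded (R : realType) (a M : R) : 0 < a ->
  exists T : nat, forall n : nat, (T < n)%N -> M <= n%:R `^ a.
Proof.
move=> a0; exists (Num.trunc ((1 + `|M|) `^ a^-1)) => n.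
rewrite truncn_lt_nat ?powR_ge0// => Mn.
apply: (@le_trans _ _ (1 + `|M|)); first by have := ler_norm M; lra.
have -> : 1 + `|M| = ((1 + `|M|) `^ a^-1) `^ a.
  by rewrite -powRrM mulVf ?gt_eqF// powRr1// addr_ge0.
by rewrite ge0_ler_powR ?nnegrE ?powR_ge0 ?(ltW a0) ?(ltW Mn).
Qed.

Lemma finite_bounded_rat_rows (d M : nat) :
  finite_set [set r : 'rV[rat]_d | forall i,
    (`|numq (r ord0 i)| <= M)%N && (`|denq (r ord0 i)| <= M)%N].
Proof.
pose m (f : {ffun 'I_d -> bool * ('I_M.+1 * 'I_M.+1)}) : 'rV[rat]_d :=
  \row_i (((-1) ^+ (f i).1 * (f i).2.1%:Z)%:~R / (f i).2.2%:R).
apply: (@sub_finite_set _ _ (m @` setT)); last exact/finite_image/finite_finset.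
move=> r rM; exists [ffun i => (numq (r ord0 i) < 0,
  (inord `|numq (r ord0 i)|, inord `|denq (r ord0 i)|))] => //.
apply/rowP => i; rewrite mxE ffunE /=; have /andP[h1 h2] := rM i.
rewrite !inordK// -intEsign -[RHS]divq_num_den; congr (_ / _).
by rewrite pmulrn absz_denq.
Qed.

Lemma natr_absz_numq (R : realType) (r : rat) :
  `|numq r|%N%:R = `|ratr r| * `|denq r|%N%:R :> R.
Proof.
have d0 : 0 <= ratr (denq r)%:~R :> R by rewrite ratr_int ler0z denq_ge0.
have -> : `|denq r|%N%:R = ratr (denq r)%:~R :> R.
  by rewrite ratr_int pmulrn absz_denq.
rewrite -[X in _ * X](ger0_norm d0) -normrM -rmorphM /= -numqE ratr_int.
by rewrite natr_absz -intr_norm.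
Qed.

Definition den_prod {d : nat} (r : 'rV[rat]_d) : nat :=
  \prod_i denominators r i.

Definition prod_radius {R : realType} {d : nat} (tau : R) (r : 'rV[rat]_d) : R :=
  theta_prod (denominators r) `^ (- tau).

Definition approx_box {R : realType} {d : nat} (tau : R) (r : 'rV[rat]_d) :
    set 'rV[R]_d :=
  [set x | forall i, `|x ord0 i - ratr (r ord0 i)| < prod_radius tau r].

(** * Efficient covers by approximation boxes *)

Section UpperBound.
Context {R : realType} {d : nat} (tau : R).
Context (d0 : (0 < d)%N) (tau0 : 0 < tau).

Implicit Types r : 'rV[rat]_d.

Local Notation rad := (prod_radius tau).
Local Notation box := (approx_box tau).

Let dR : 0 < d%:R :> R. Proof. by rewrite ltr0n. Qed.

Let den_gt0 r i : (0 < denominators r i)%N.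
Proof. by rewrite absz_gt0 denq_neq0. Qed.

Let den_prod_gt0 r : (0 < den_prod r)%N.
Proof. by apply: prodn_gt0 => i; exact: den_gt0. Qed.

Let radE r : rad r = (den_prod r)%:R `^ (- (tau / d%:R)).
Proof. by rewrite /prod_radius /theta_prod -powRrM mulrN mulrC. Qed.

Let rad_gt0 r : 0 < rad r.
Proof. by rewrite radE powR_gt0// ltr0n. Qed.

Let rad_le1 r : rad r <= 1.
Proof.
rewrite radE powRN invf_le1; last by rewrite powR_gt0// ltr0n.
by rewrite -[leLHS](powRr0 (den_prod r)%:R) ler_powR ?ler1n// divr_ge0 ?ltW.
Qed.

Lemma den_le_den_prod r i : (denominators r i <= den_prod r)%N.
Proof.
rewrite /den_prod (bigD1 i)//= leq_pmulr//.
by apply: prodn_gt0 => j; exact: den_gt0.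
Qed.

Lemma diameter_box r :
  (diameter euclidean_dist (box r) <= (d%:R * (2 * rad r))%:E)%E.
Proof.
apply: ge_ereal_sup => _ [x [y [xr yr ->]]]; rewrite lee_fin.
have r0 := rad_gt0 r; apply: euclidean_dist_le => [|i]; first by lra.
have := xr i; have := yr i.
rewrite (distrC (y ord0 i)).
have := ler_normD (x ord0 i - ratr (r ord0 i)) (ratr (r ord0 i) - y ord0 i).
by rewrite subrKA; lra.
Qed.

Lemma gauge_box_le s r : 0 <= s ->
  (gauge euclidean_dist s (box r) <= ((d%:R * (2 * rad r)) `^ s)%:E)%E.
Proof.
move=> s0; rewrite /gauge; case: ifPn => [_|/set0P box0].
  by rewrite lee_fin powR_ge0.
have [D [-> D0 D1 _]] := diameterP box0 (diameter_box r).
by rewrite lee_fin ge0_ler_powR// nnegrE (le_trans D0).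
Qed.

(** Bounded entries give [|p_i| <= B q_i], so [q_i (|p_i| + 1) <= (1 + B) q_i^2]. *)
Lemma rat_row_weight_ge (kappa B : R) r : 0 <= kappa ->
  (forall i, `|ratr (r ord0 i)| <= B) ->
  ((1 + B) ^+ d) `^ (- kappa) * (den_prod r)%:R `^ (- (2 * kappa)) <=
  rat_row_weight kappa r.
Proof.
move=> k0 rB.
have B0 : 0 <= B by have := rB (Ordinal d0); apply: le_trans.
have -> : ((1 + B) ^+ d) `^ (- kappa) * (den_prod r)%:R `^ (- (2 * kappa)) =
    \prod_i ((1 + B) * (denominators r i)%:R ^+ 2) `^ (- kappa).
  rewrite prod_powR; last by move=> i; rewrite mulr_ge0 ?sqr_ge0//; lra.
  rewrite big_split /= prodr_const card_ord powRM; last 2 first.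
  - by rewrite exprn_ge0//; lra.
  - by apply: prodr_ge0 => i _; exact: sqr_ge0.
  congr (_ * _); rewrite prodrXl -natr_prod -mulrN powRrM powR_mulrn//.
rewrite /rat_row_weight; apply: ler_prod => i _; rewrite powR_ge0 /=.
set q := denominators r i; set p := `|numq (r ord0 i)|%N.
have q0 : 1 <= q%:R :> R by rewrite ler1n den_gt0.
have pB : p%:R <= B * q%:R :> R.
  by rewrite /p natr_absz_numq ler_wpM2r.
rewrite /rat_weight -/p -[`|denq _|%N]/q natrM -natr1 !powRN.
have h : q%:R * (p%:R + 1) <= (1 + B) * q%:R ^+ 2 :> R.
  by rewrite expr2 mulrA mulrC ler_wpM2r//; lra.
have h0 : 0 < q%:R * (p%:R + 1) :> R.
  by have := ler0n R p; move=> ?; apply: mulr_gt0; lra.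
have h1 : 0 < (1 + B) * q%:R ^+ 2 by exact: lt_le_trans h.
by rewrite lef_pV2 ?posrE ?powR_gt0// ge0_ler_powR ?nnegrE ?(ltW h0) ?(ltW h1).
Qed.

(** If no such row existed, every box containing [x] would have denominator product at most some
    [T]; its numerators would then be bounded too, leaving finitely many rows. *)
Lemma eventually_small s kappa (eps delta : R) x :
  0 <= s -> 0 <= kappa -> 2 * kappa < tau * s / d%:R -> 0 < eps -> 0 < delta ->
  S_ theta_prod tau x ->
  exists r, [/\ box r x,
    (d%:R * (2 * rad r)) `^ s <= eps * rat_row_weight kappa r &
    d%:R * (2 * rad r) <= delta].
Proof.
move=> s0 k0 ks eps0 delta0 xS; apply: contrapT => nex; apply: xS.
pose B := \sum_i (`|x ord0 i| + 1).
have rB r : box r x -> forall i, `|ratr (r ord0 i)| <= B.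
  move=> rx i; apply: (@le_trans _ _ (`|x ord0 i| + 1)); last first.
    rewrite /B (bigD1 i)//= -[leLHS]addr0 lerD2l; apply: sumr_ge0 => j _.
    exact: addr_ge0.
  have := rx i; have := rad_le1 r; rewrite distrC.
  by have := ler_normD (ratr (r ord0 i) - x ord0 i) (x ord0 i); rewrite subrK; lra.
have B0 : 0 <= B by apply: sumr_ge0 => i _; exact: addr_ge0.
pose b := ((1 + B) ^+ d) `^ (- kappa).
have b0 : 0 < b by rewrite powR_gt0// exprn_gt0//; lra.
(* Beyond [T1] the weight inequality holds, because [tau s / d > 2 kappa]; beyond [T2] the diameter
   bound holds. *)
have [|T1 T1P] := @powR_unbounded R (tau * s / d%:R - 2 * kappa)
  ((d%:R * 2) `^ s / (eps * b)); first by lra.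
have [|T2 T2P] := @powR_unbounded R (tau / d%:R) (d%:R * 2 / delta).
  by rewrite divr_gt0.
pose T := maxn T1 T2.
have bounded r : box r x -> (den_prod r <= T)%N.
  move=> rx; rewrite leqNgt gtn_max; apply/negP => /andP[PT1 PT2]; apply: nex.
  have := T1P _ PT1; have := T2P _ PT2; set P := (den_prod r)%:R => h2 h1.
  have P0 : 0 < P by rewrite ltr0n.
  exists r; split => //; last first.
    rewrite mulrA radE -/P powRN ler_pdivrMr ?powR_gt0//.
    by rewrite [leRHS]mulrC; move: h2; rewrite ler_pdivrMr.
  apply: (@le_trans _ _ (eps * (b * P `^ (- (2 * kappa))))); last first.
    by rewrite ler_pM2l//; apply: rat_row_weight_ge => //; exact: rB.
  rewrite mulrA powRM ?mulr_ge0 ?(ltW (rad_gt0 r))// radE -/P -powRrM.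
  have -> : - (tau / d%:R) * s = - (tau * s / d%:R) by ring.
  rewrite [X in _ * X]powRN ler_pdivrMr ?powR_gt0//.
  move: h1; rewrite ler_pdivrMr ?mulr_gt0// powRD; last by rewrite lt0r_neq0 ?implybT.
  by move=> /le_trans; apply; rewrite le_eqVlt; apply/orP; left; apply/eqP; ring.
pose M := (T + Num.trunc (B * T%:R))%N.
apply: sub_finite_set (finite_bounded_rat_rows d M) => r rx i.
have qT : (denominators r i <= T)%N.
  exact: leq_trans (den_le_den_prod r i) (bounded r rx).
apply/andP; split; last by rewrite (leq_trans qT)// leq_addr.
apply: (@leq_trans (Num.trunc (B * T%:R))); last exact: leq_addl.
rewrite truncn_ge_nat ?mulr_ge0// natr_absz_numq.
by apply: ler_pM => //; [exact: rB|rewrite ler_nat].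
Qed.

Lemma hausdorff_measure_eq0 s (A : set 'rV[R]_d) :
  A `<=` S_ theta_prod tau -> 2 * d%:R / tau < s ->
  hausdorff_measure euclidean_dist s A = 0%E.
Proof.
move=> AS hs.
have s0 : 0 <= s by apply: ltW; apply: le_lt_trans hs; rewrite divr_ge0 ?mulr_ge0 ?ltW.
have gauge0 U : (0 <= gauge (@euclidean_dist R d) s U)%E.
  by rewrite /gauge; case: ifP => // _; exact: poweR_ge0.
have pre0 delta : (0 <= hausdorff_premeasure euclidean_dist s delta A)%E.
  by apply: le_ereal_inf_tmp => _ [U _ <-]; apply: nneseries_ge0.
suff pre_le delta : 0 < delta ->
    (hausdorff_premeasure euclidean_dist s delta A <= 0)%E.
  apply/eqP; rewrite eq_le; apply/andP; split.
    by apply: ge_ereal_sup => _ [delta /= delta0 <-]; exact: pre_le.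
  apply: le_ereal_sup_tmp.
  by exists (hausdorff_premeasure euclidean_dist s 1 A);
    [exists 1; [exact: ltr01|]|exact: pre0].
move=> delta0; apply/lee_addgt0Pr => eps eps0; rewrite add0e.
set sigma := tau * s / d%:R.
have sigma2 : 2 < sigma.
  by move: hs; rewrite ltr_pdivrMr// /sigma ltr_pdivlMr// (mulrC s).
(* The midpoint of 1 and [sigma / 2]: large enough for summable weights, small enough for
   [eventually_small]. *)
pose kappa := (1 + sigma / 2) / 2.
have k1 : 1 < kappa by rewrite /kappa; lra.
have ks : 2 * kappa < sigma by rewrite /kappa; lra.
have [K K0 KP] := @sum_rat_row_weight_bounded R kappa d k1.
pose eps' := eps / K; have eps'0 : 0 < eps' by rewrite divr_gt0.
have w0 (r : 'rV[rat]_d) : 0 <= rat_row_weight kappa r.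
  by apply: prodr_ge0 => i _; exact: powR_ge0.
pose good r := ((d%:R * (2 * rad r)) `^ s <= eps' * rat_row_weight kappa r) &&
  (d%:R * (2 * rad r) <= delta).
(* The rows are enumerated by their codes. Codes of no row and rows that are not [good] give the
   empty set, whose gauge is 0. *)
pose U n : set 'rV[R]_d :=
  if pickle_inv n is Some r then (if good r then box r else set0) else set0.
have diam0 : (diameter (@euclidean_dist R d) set0 <= delta%:E)%E.
  by apply: ge_ereal_sup => z [x [y []]].
apply: (@le_trans _ _ (\sum_(0 <= n <oo) gauge euclidean_dist s (U n))%E).
  apply: ereal_inf_lbound; exists U => //; split.
    move=> x /AS xS; have [r [rx h1 h2]] :=
      eventually_small s0 (ltW (lt_trans ltr01 k1)) ks eps'0 delta0 xS.
    exists (pickle r) => //; rewrite /U pickleK_inv /good h1 h2.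
    exact: rx.
  move=> n; rewrite /U; case: pickle_inv => // r; case: ifPn => // /andP[_ h].
  by apply: (le_trans (diameter_box r)); rewrite lee_fin.
apply: lime_le; first by apply: is_cvg_nneseries => n _ _; exact: gauge0.
apply: nearW => N.
have gU n : (gauge euclidean_dist s (U n) <=
    (oapp (fun r : 'rV[rat]_d => eps' * rat_row_weight kappa r) 0 (pickle_inv n))%:E)%E.
  have g0 : gauge (@euclidean_dist R d) s set0 = 0%E by rewrite /gauge eqxx.
  rewrite /U; case: pickle_inv => [r|] /=; last by rewrite g0.
  case: ifPn => [/andP[h _]|_]; last by rewrite g0 lee_fin mulr_ge0// ltW.
  by apply: (le_trans (gauge_box_le _ s0)); rewrite lee_fin.
apply: (le_trans (lee_sum _ (fun n _ => gU n))).
(* A partial sum runs over the duplicate-free list of rows with code below [N], so its weights total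
   at most [K]. *)
rewrite sumEFin lee_fin -(@big_pmap _ _ _ _ _ pickle_inv) -mulr_sumr.
have := KP (pmap pickle_inv (index_iota 0 N)) (pmap_uniq pickle_invK (iota_uniq _ _)).
rewrite -(ler_pM2l eps'0) => /le_trans; apply.
by rewrite /eps' divfK// gt_eqF.
Qed.

Lemma hausdorff_dim_le (A : set 'rV[R]_d) : A `<=` S_ theta_prod tau ->
  (hausdorff_dim euclidean_dist A <= (2 * d%:R / tau)%:E)%E.
Proof.
move=> AS; apply/lee_addgt0Pr => e e0; apply: ereal_inf_lbound.
have p0 : 0 <= 2 * d%:R / tau by rewrite divr_ge0 ?mulr_ge0 ?ltW.
exists (2 * d%:R / tau + e); last by rewrite EFinD.
split; first by lra.
by apply: hausdorff_measure_eq0 => //; rewrite ltrDl.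
Qed.

End UpperBound.

(** * Comparison of the two heights *)

Lemma theta_prod_le_max (R : realType) (d : nat) (q : 'I_d -> nat) :
  (0 < d)%N -> theta_prod q <= theta_max q :> R.
Proof.
move=> d0; rewrite /theta_prod /theta_max; set m := \max_i q i.
have dn0 : d%:R != 0 :> R by rewrite pnatr_eq0 -lt0n.
have -> : m%:R = (m ^ d)%N%:R `^ d%:R^-1 :> R.
  by rewrite natrX -powR_mulrn// -powRrM mulfV// powRr1.
rewrite ge0_ler_powR ?nnegrE ?invr_ge0// ler_nat.
rewrite -[d in (m ^ d)%N]card_ord -prod_nat_const.
by apply: leq_prod => i _; exact: leq_bigmax.
Qed.

Lemma S_max_sub_prod (R : realType) (d : nat) (tau : R) : (0 < d)%N -> 0 <= tau ->
  @S_ R d theta_max tau `<=` S_ theta_prod tau.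
Proof.
move=> d0 tau0 x; apply: sub_infinite_set => r rx i.
apply: (lt_le_trans (rx i)).
have p0 : 0 < theta_prod (denominators r) :> R.
  rewrite powR_gt0// ltr0n; apply: prodn_gt0 => j.
  by rewrite absz_gt0 denq_neq0.
have pm := @theta_prod_le_max R d (denominators r) d0.
have m0 := lt_le_trans p0 pm.
rewrite !powRN lef_pV2 ?posrE ?(powR_gt0 _ p0) ?(powR_gt0 _ m0)//.
by apply: ge0_ler_powR => //; rewrite nnegrE ltW.
Qed.

Theorem theorem1p3 (R : realType) (d : nat) (hd : (1 <= d)%N)
    (Theta : ('I_d -> nat) -> R)
    (hTheta : Theta = theta_max \/ Theta = theta_prod)
    (tau : R) (htau : 2 <= tau) :
  hausdorff_dim euclidean_dist (S_ Theta tau) = (2 * d%:R / tau)%:E.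
Proof.
have tau0 : 0 < tau by lra.
have sub := @S_max_sub_prod R d tau hd (ltW tau0).
apply/eqP; rewrite eq_le; apply/andP; split.
- by apply: hausdorff_dim_le => //; case: hTheta => ->.
- by apply: hausdorff_dim_ge => //; case: hTheta => ->.
Qed.
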